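(* Let $K\in\mathbb{R}$, let $(X,\mathsf{d},\mathfrak m)$ be an extended metric measure space, and let $\Omega$ be a probability measure on $\mathcal{P}(X)$ with finite variance. Assume that every $\mu\in\mathcal{P}(X)$ which has finite $W_2$-distance to $\mathrm{D}(\mathrm{Ent}_{\mathfrak m})=\{\nu:\mathrm{Ent}_{\mathfrak m}(\nu)<\infty\}$ is the starting point of an $\mathrm{EVI}_K$ gradient flow of $\mathrm{Ent}_{\mathfrak m}$ in the Wasserstein space $(\mathcal{P}(X),W_2)$. Then for every Wasserstein barycenter $\bar\mu$ of $\Omega$, $$\mathrm{Ent}_{\mathfrak m}(\bar\mu)\le \int_{\mathcal{P}(X)}\mathrm{Ent}_{\mathfrak m}(\mu)\,d\Omega(\mu)-\frac K2\int_{\mathcal{P}(X)}W_2^2(\bar\mu,\mu)\,d\Omega(\mu).$$ As a consequence, if $\int_{\mathcal{P}(X)}\mathrm{Ent}_{\mathfrak m}(\mu)\,d\Omega(\mu)<\infty$, then every barycenter of $\Omega$ is absolutely continuous with respect to $\mathfrak m$.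
   Context: An extended metric space $(X,\mathsf{d})$: $\mathsf{d}:X\times X\to[0,+\infty]$ symmetric, satisfying the triangle inequality, with $\mathsf{d}(x,y)=0$ iff $x=y$. An extended metric measure space $(X,\mathsf{d},\mathfrak m)$: $X$ carries a Hausdorff topology $\tau$ such that $(X,\tau,\mathsf{d})$ is an extended metric-topological space in the sense of Ambrosio–Erbar–Savaré (compatibility of $\tau$ and $\mathsf{d}$), $(X,\mathsf{d})$ is complete, and $\mathfrak m$ is a nonnegative Radon probability measure on the Borel sets of $\tau$ with full support. $\mathcal{P}(X)$ is the set of Radon probability measures on $X$, with the (extended) quadratic Wasserstein distance $W_2^2(\mu,\nu)=\inf_{\pi}\int \mathsf{d}^2(x,y)\,d\pi(x,y)$, infimum over couplings $\pi$ of $\mu,\nu$. $\mathcal P(X)$ is endowed with a Hausdorff topology making it an extended metric-topological space with $W_2$, singletons measurable, and $\Omega$ is a Radon probability measure on it. $\Omega$ has finite variance if $\mathrm{Var}(\Omega):=\inf_{\nu\in\mathcal P(X)}\int W_2^2(\mu,\nu)\,d\Omega(\mu)<\infty$; a Wasserstein barycenter of $\Omega$ is a $\bar\nu\in\mathcal P(X)$ attaining this infimum. Relative entropy: $\mathrm{Ent}_{\mathfrak m}(\mu)=\int\rho\ln\rho\,d\mathfrak m$ if $\mu=\rho\mathfrak m$, $+\infty$ otherwise. $\mathrm{EVI}_K$ gradient flow of a lower semicontinuous $E:Y\to\mathbb{R}\cup\{+\infty\}$ on an extended metric space $(Y,\mathsf{d}_Y)$ starting at $y_0$: a locally absolutely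 continuous curve $(0,\infty)\ni t\mapsto y_t$ with $y_t\to y_0$ in $\mathsf{d}_Y$ as $t\to0$, such that for every $z\in\mathrm{D}(E)=\{E<\infty\}$ with $\mathsf{d}_Y(z,y_t)<\infty$ for some (hence all) $t>0$, $\frac12\frac{d}{dt}\mathsf{d}_Y^2(y_t,z)+\frac K2\mathsf{d}_Y^2(y_t,z)\le E(z)-E(y_t)$ for a.e. $t>0$; if $y_0\notin\mathrm D(E)$ one requires instead $\liminf_{t\downarrow0}E(y_t)\ge E(y_0)$ and $\mathsf{d}_Y(y_t,y)\to\mathsf{d}_Y(y_0,y)$ for all $y\in\overline{\mathrm D(E)}$. *)

(* Defs.v *)
From HB Require Import structures.
From mathcomp Require Import all_boot all_order all_algebra.
From mathcomp Require Import all_classical all_reals all_analysis.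
Set Implicit Arguments. Unset Strict Implicit. Unset Printing Implicit Defensive.
Import Order.TTheory GRing.Theory Num.Theory.
Import numFieldNormedType.Exports.
Local Open Scope classical_set_scope.
Local Open Scope ring_scope.

Definition borel (T : ptopologicalType) := g_sigma_algebraType (@open T).

Definition prodT (X Y : ptopologicalType) := (X * Y)%type.
HB.instance Definition _ (X Y : ptopologicalType) := Topological.on (prodT X Y).
HB.instance Definition _ (X Y : ptopologicalType) := Pointed.on (prodT X Y).

Section Defs.
Context {R : realType}.
Local Open Scope ereal_scope.

Definition ext_metric {Y : Type} (d : Y -> Y -> \bar R) : Prop :=
  [/\ forall x y, 0 <= d x y,
      forall x y, d x y = d y x,
      forall x y z, d x z <= d x y + d y z &
      forall x y, d x y = 0 <-> x = y].

Definition ext_complete {Y : Type} (d : Y -> Y -> \bar R) : Prop :=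
  forall u : nat -> Y,
    (forall e : R, (0 < e)%R -> exists N : nat,
        forall n k, (N <= n)%N -> (N <= k)%N -> d (u n) (u k) < e%:E) ->
    exists x, forall e : R, (0 < e)%R -> exists N : nat,
        forall n, (N <= n)%N -> d (u n) x < e%:E.

Definition lip_b {T : ptopologicalType} (d : T -> T -> \bar R) (f : T -> R) :=
  [/\ continuous f,
      exists M : R, forall x, (`|f x| <= M)%R &
      exists L : R, (0 <= L)%R /\ forall x y, `|f x - f y|%:E <= L%:E * d x y].

Definition lip_b1 {T : ptopologicalType} (d : T -> T -> \bar R) (f : T -> R) :=
  lip_b d f /\ forall x y, `|f x - f y|%:E <= d x y.

(* Extended metric-topological space (Ambrosio-Erbar-Savare):
   (T, tau) Hausdorff, d an extended metric, tau is the initial topology of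
   Lip_b(T,tau,d) (the functions of Lip_b are tau-continuous by definition,
   and every tau-open set is open for the initial topology), and d is
   recovered by bounded continuous 1-Lipschitz functions. *)
Definition emt_space {T : ptopologicalType} (d : T -> T -> \bar R) : Prop :=
  [/\ hausdorff_space T, ext_metric d,
      (forall (U : set T), open U -> forall x, U x ->
         exists (n : nat) (fs : 'I_n -> T -> R) (e : R),
           [/\ (0 < e)%R, (forall i, lip_b d (fs i)) &
               [set y | forall i, (`|fs i y - fs i x| < e)%R] `<=` U]) &
      forall x y, d x y =
        ereal_sup [set `|f x - f y|%:E | f in [set f | lip_b1 d f]]].

Definition radon {T : ptopologicalType} (mu : set (borel T) -> \bar R) : Prop :=
  mu setT < +oo /\
  forall B : set (borel T), measurable B ->
    mu B = ereal_sup [set mu C | C in [set C : set T | compact C /\ C `<=` B]].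

Definition radon_prob {T : ptopologicalType} (mu : set (borel T) -> \bar R) :=
  radon mu /\ mu setT = 1.

Definition emm_space {X : ptopologicalType} (d : X -> X -> \bar R)
    (m : {measure set (borel X) -> \bar R}) : Prop :=
  [/\ emt_space d, ext_complete d, radon_prob m &
      forall U : set X, open U -> U !=set0 -> 0 < m U].

Definition coupling {X : ptopologicalType} (mu nu : set (borel X) -> \bar R)
    (pi : set (borel (prodT X X)) -> \bar R) : Prop :=
  radon_prob pi /\
  forall A : set (borel X), measurable A ->
    pi (A `*` setT) = mu A /\ pi (setT `*` A) = nu A.

Definition W2sq {X : ptopologicalType} (d : X -> X -> \bar R)
    (mu nu : set (borel X) -> \bar R) : \bar R :=
  ereal_inf [set \int[pi]_z (d z.1 z.2) ^+ 2
            | pi in [set pi : {measure set (borel (prodT X X)) -> \bar R}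
                    | coupling mu nu pi]].

Definition W2 {X : ptopologicalType} (d : X -> X -> \bar R)
    (mu nu : set (borel X) -> \bar R) : \bar R := sqrte (W2sq d mu nu).

Definition is_density {X : ptopologicalType} (m : {measure set (borel X) -> \bar R})
    (mu : set (borel X) -> \bar R) (rho : X -> R) : Prop :=
  [/\ measurable_fun (setT : set (borel X)) rho,
      (forall x, 0 <= rho x)%R &
      forall A : set (borel X), measurable A ->
        mu A = \int[m]_(x in A) (rho x)%:E].

(* Ent_m(mu) = int rho ln rho dm if mu = rho m, +oo otherwise
   (with the convention 0 ln 0 = 0; ln 0 = 0 in MathComp-Analysis) *)
Definition Ent {X : ptopologicalType} (m : {measure set (borel X) -> \bar R})
    (mu : set (borel X) -> \bar R) : \bar R :=
  match pselect (exists rho, is_density m mu rho) with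
  | left h => let rho := projT1 (cid h) in
              \int[m]_x (rho x * ln (rho x))%:E
  | right _ => +oo
  end.

Definition loc_abs_cont {Y : Type} (dY : Y -> Y -> \bar R) (y : R -> Y) :=
  forall a b : R, (0 < a)%R -> (a <= b)%R ->
    exists g : R -> R,
      (@lebesgue_measure R).-integrable `[a, b] (EFin \o g) /\
      forall s t : R, (a <= s)%R -> (s <= t)%R -> (t <= b)%R ->
        dY (y s) (y t) <= \int[@lebesgue_measure R]_(u in `[s, t]) (g u)%:E.

Definition EVI_flow {Y : Type} (K : R) (E : Y -> \bar R) (dY : Y -> Y -> \bar R)
    (y0 : Y) (y : R -> Y) : Prop :=
  [/\ loc_abs_cont dY y,
      (if pselect (E y0 < +oo) is left _ then
         forall e : R, (0 < e)%R -> exists delta : R, (0 < delta)%R /\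
           forall t : R, (0 < t < delta)%R -> dY (y t) y0 < e%:E
       else
         (forall c : \bar R, c < E y0 -> exists delta : R, (0 < delta)%R /\
            forall t : R, (0 < t < delta)%R -> c < E (y t)) /\
         (forall z, (forall e : R, (0 < e)%R -> exists w, E w < +oo /\ dY z w < e%:E) ->
            (fun t => dY (y t) z) x @[x --> (0:R)^'+] --> dY y0 z)) &
      forall z, E z < +oo -> (exists t : R, (0 < t)%R /\ dY z (y t) < +oo) ->
        {ae @lebesgue_measure R, forall t : R, (0 < t)%R ->
           let f := fun s : R => (fine (dY (y s) z) ^+ 2)%R in
           derivable f t 1 /\
           (2^-1 * 'D_1 f t + K / 2 * f t)%:E <= E z - E (y t)}].

(* P models P(X): iota is a bijection from P onto the Radon probability
   measures on X; W2 on P is transported along iota. *)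
Definition models_PX {X P : ptopologicalType} (iota : P -> {measure set (borel X) -> \bar R}) :=
  injective iota /\
  forall mu : {measure set (borel X) -> \bar R}, radon_prob mu <-> exists p, iota p = mu.

Definition Var {X P : ptopologicalType} (d : X -> X -> \bar R)
    (iota : P -> {measure set (borel X) -> \bar R})
    (Om : set (borel P) -> \bar R) : \bar R :=
  ereal_inf ((fun q : P => \int[Om]_w W2sq d (iota w) (iota q)) @` setT).

Definition barycenter {X P : ptopologicalType} (d : X -> X -> \bar R)
    (iota : P -> {measure set (borel X) -> \bar R})
    (Om : set (borel P) -> \bar R) (b : P) : Prop :=
  \int[Om]_w W2sq d (iota w) (iota b) = Var d iota Om.

End Defs.

(* Main.v *)
Require Import Defs.
From HB Require Import structures.
From mathcomp Require Import all_boot all_order all_algebra.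
From mathcomp Require Import all_classical all_reals all_analysis.
From mathcomp Require Import measurable_realfun ring lra.
Set Implicit Arguments. Unset Strict Implicit. Unset Printing Implicit Defensive.
Import Order.TTheory GRing.Theory Num.Theory.
Import numFieldNormedType.Exports.
Local Open Scope classical_set_scope.
Local Open Scope ring_scope.

(* Let [y] be the EVI flow of [Ent] started at the barycenter [b].  Integrating
   the EVI in time, with [c] a lower bound of [Ent (y s)] for small [s],
     [e^(K t) W2^2(y t, w) + 2 I(t) c <= 2 I(t) Ent w + W2^2(b, w)],
   where [I' = e^(K t)] and [I(0) = 0].  Integrating over [w] and using that [b]
   minimizes the variance, [int W2^2(y t, w) >= Var], the factor
   [e^(K t) - 1 = K I(t)] yields [c + (K / 2) Var <= int Ent]; finally [c] tends
   to [Ent b]: by definition of the flow if [Ent b] is infinite, and otherwise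
   because [Ent] is W2-lower semicontinuous at [b], which follows from the duality
     [Ent q = sup_phi (int phi dq + 1 - int e^phi dm)]
   and the density of bounded Lipschitz functions in L1 of a Radon measure.
   [Ent] is not known to be measurable on [P], so [int Ent] is treated as a lower
   integral and bounded below through a measurable minorant. *)

(** * Monotonicity of absolutely continuous functions *)

(** A flow from [b] is available because finiteness of [int Ent] and of the variance gives one [w]
    of finite entropy at finite distance from [b]; if [int Ent] is infinite there is nothing to
    prove. One small time [t] suffices: after division by [2 I(t)] the integrated inequality no
    longer depends on [t], so nothing is differentiated at time 0. The EVI holds only almost
    everywhere, for a squared distance that is only locally absolutely continuous on the open
    half-line. Its integration therefore rests on the monotonicity of absolutely continuous
    functions with a.e. nonpositive derivative, followed by a limit at time 0. For lower
    semicontinuity, W2-closeness controls integrals of functions that are Lipschitz for [d], not of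
    arbitrary continuous ones. The optimal test function [ln rho] is thus truncated, then replaced
    by a single bounded Lipschitz function close to it in L1 of both [m] and [b]. *)

Lemma local_nonincr {R : realType} (h : R -> R) (a b : R) : a <= b ->
  (forall x, a <= x <= b -> exists2 e : R, 0 < e &
     forall y, a <= y <= b -> `|y - x| < e ->
       (y <= x -> h x <= h y) /\ (x <= y -> h y <= h x)) ->
  h b <= h a.
Proof.
move=> ab loc.
(* The left half of the local condition at [sup S] places [sup S] in [S]; the right half then
   produces a larger element of [S] unless [sup S = b]. *)
pose S := [set x | a <= x <= b /\ h x <= h a].
have Sa : S a by rewrite /S /= lexx ab lexx.
have Sub : ubound S b by move=> x [/andP[]].
have hS : has_sup S by split; [exists a | exists b].
have as_ : a <= sup S by apply: ub_le_sup Sa; exists b.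
have sb : sup S <= b by apply: ge_sup => //; exists a.
have [e e0 He] := loc (sup S) (introT andP (conj as_ sb)).
have hs : h (sup S) <= h a.
  have [y [yab hya] ye] := sup_adherent e0 hS.
  have ys : y <= sup S by apply: ub_le_sup => //; exists b.
  apply: le_trans hya; have [|+ _] := He _ yab; last exact.
  by rewrite ler0_norm; lra.
have [<-//|sb'] := eqVneq (sup S) b.
have {}sb : sup S < b by rewrite lt_neqAle sb'.
pose y := Num.min (sup S + e / 2) b.
have ys : sup S < y by rewrite lt_min sb andbT; lra.
have yb : y <= b by rewrite ge_min lexx orbT.
have ye : y <= sup S + e / 2 by rewrite ge_min lexx.
have yab : a <= y <= b by apply/andP; split; lra.
have [|_ /(_ (ltW ys)) hy] := He _ yab; first by rewrite gtr0_norm; lra.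
have : y <= sup S.
  by apply: ub_le_sup; [exists b | split => //; exact: le_trans hs].
by rewrite leNgt ys.
Qed.

Section abs_cont.
Context {R : realType}.
Notation mu := (@lebesgue_measure R).
Implicit Types (f g G : R -> R) (a b : R).

(** Absolute continuity through an integrable modulus, as in [loc_abs_cont], so that distances along
    a flow satisfy it by the triangle inequality. A nonnegative modulus on the whole line makes its
    integral monotone in the set without domain conditions. *)
Definition ac f a b := exists G, [/\ mu.-integrable setT (EFin \o G),
  (forall x, 0 <= G x) &
  forall s t, a <= s -> s <= t -> t <= b ->
    `|f t - f s| <= \int[mu]_(x in `[s, t]) G x].

Lemma integrable_sub G (A : set R) : measurable A ->
  mu.-integrable setT (EFin \o G) -> mu.-integrable A (EFin \o G).
Proof. by move=> mA; apply: integrableS. Qed.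

Lemma le_Rintegral_sub G (A B : set R) : mu.-integrable setT (EFin \o G) ->
  (forall x, 0 <= G x) -> measurable A -> measurable B -> A `<=` B ->
  \int[mu]_(x in A) G x <= \int[mu]_(x in B) G x.
Proof.
move=> iG G0 mA mB AB; apply: fine_le.
- exact/integrable_fin_num/integrable_sub.
- exact/integrable_fin_num/integrable_sub.
- apply: ge0_subset_integral => //.
    apply: measurable_funS (measurable_int mu iG) => //; exact: subsetT.
  by move=> x _; rewrite /= lee_fin.
Qed.

Lemma ac_bounded f a b : ac f a b ->
  exists2 M, 0 <= M & forall x, a <= x <= b -> `|f x| <= M.
Proof.
move=> [G [iG G0 fG]].
exists (`|f a| + \int[mu]_(x in `[a, b]) G x).
  by rewrite addr_ge0// Rintegral_ge0.
move=> x /andP[ax xb].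
have -> : f x = f a + (f x - f a) by ring.
rewrite (le_trans (ler_normD _ _))// lerD2l (le_trans (fG a x _ _ _))//.
apply: le_Rintegral_sub => // y; rewrite /= !in_itv/= => /andP[-> yx].
exact: le_trans xb.
Qed.

(** Common source of stability under differences and products; the modulus is
    [k1 * g1 + k2 * g2]. *)
Lemma ac_le_comb f1 f2 (k1 k2 : R) f a b : ac f1 a b -> ac f2 a b ->
  0 <= k1 -> 0 <= k2 ->
  (forall s t, a <= s -> s <= t -> t <= b ->
    `|f t - f s| <= k1 * `|f1 t - f1 s| + k2 * `|f2 t - f2 s|) ->
  ac f a b.
Proof.
move=> [g1 [ig1 g10 fg1]] [g2 [ig2 g20 fg2]] k10 k20 H.
have iZ (k : R) (g : R -> R) : mu.-integrable setT (EFin \o g) ->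
    mu.-integrable setT (EFin \o (fun x => k * g x)).
  move=> ig; rewrite (_ : EFin \o _ = fun x => (k%:E * (g x)%:E)%E) //.
  exact: integrableZl.
exists (fun x => k1 * g1 x + k2 * g2 x); split.
- rewrite (_ : EFin \o _ = fun x => ((k1 * g1 x)%:E + (k2 * g2 x)%:E)%E) //.
  by apply: integrableD => //; exact: (iZ _ _ _).
- by move=> x; rewrite addr_ge0// mulr_ge0.
- move=> s t as_ st tb.
  rewrite RintegralD//; [|exact/integrable_sub/iZ|exact/integrable_sub/iZ].
  rewrite !RintegralZl//; [|exact: integrable_sub|exact: integrable_sub].
  by rewrite (le_trans (H s t _ _ _))// lerD// ler_wpM2l// ?fg1 ?fg2.
Qed.

Lemma acB f g a b : ac f a b -> ac g a b -> ac (fun x => f x - g x) a b.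
Proof.
move=> acf acg; apply: (ac_le_comb acf acg ler01 ler01) => s t _ _ _.
rewrite !mul1r (_ : _ - _ = (f t - f s) - (g t - g s)); last by ring.
exact: ler_normB.
Qed.

Lemma acM f g a b : ac f a b -> ac g a b -> ac (fun x => f x * g x) a b.
Proof.
move=> acf acg.
have [Mf Mf0 fM] := ac_bounded acf; have [Mg Mg0 gM] := ac_bounded acg.
apply: (ac_le_comb acf acg Mg0 Mf0) => s t as_ st tb.
have -> : f t * g t - f s * g s = g t * (f t - f s) + f s * (g t - g s) by ring.
have ? : a <= t <= b by rewrite tb (le_trans as_).
have ? : a <= s <= b by rewrite as_ (le_trans st).
rewrite (le_trans (ler_normD _ _))// !normrM lerD// ler_wpM2r//.
  exact: gM.
exact: fM.
Qed.

(** Mean value theorem; the constant [M] is cut off outside [[a, b]] to be integrable on the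
    line. *)
Lemma ac_deriv f (df : R -> R) a b (M : R) : (forall x : R, is_derive x 1 f (df x)) ->
  (forall x, a <= x <= b -> `|df x| <= M) -> ac f a b.
Proof.
move=> fdf dfM.
have [ab|ba] := leP a b; last first.
  exists (fun=> 0); split => //; first exact: integrable0.
  by move=> s t as_ st tb; have := le_trans as_ (le_trans st tb); rewrite leNgt ba.
have M0 : 0 <= M by apply: le_trans (dfM a _) => //; rewrite lexx.
exists (M \o* \1_`[a, b]); split.
- rewrite (_ : EFin \o _ = fun x => (M%:E * (\1_`[a, b] x)%:E)%E); last first.
    by apply/funext => x /=; rewrite mulrC.
  apply: integrableZl => //.
  exact: integrable_indic_itv.
- by move=> x; rewrite /= mulr_ge0.
- move=> s t as_ st tb.
  rewrite (_ : \int[mu]_(x in _) _ = \int[mu]_(x in `[s, t]) M); last first.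
    apply: eq_Rintegral => x; rewrite inE /= in_itv /= => /andP[sx xt].
    by rewrite indicE mem_set ?mul1r//= in_itv /= (le_trans as_)//= (le_trans xt).
  rewrite Rintegral_cst//= lebesgue_measure_itv /= lte_fin.
  have cf : continuous f.
    by move=> x; apply/differentiable_continuous/derivable1_diffP.
  have [c] := @MVT_segment R f df s t st (fun x _ => fdf x)
    (continuous_subspaceT cf).
  rewrite in_itv /= => /andP[sc ct] ->.
  rewrite normrM (ger0_norm (_ : 0 <= t - s)) ?subr_ge0//.
  have [lst|] := ltP s t; last first.
    move=> ts; have -> : t = s by apply/eqP; rewrite eq_le ts st.
    by rewrite subrr !mulr0.
  by rewrite /= ler_wpM2r ?subr_ge0// dfM// (le_trans as_)//= (le_trans ct).
Qed.

(* The exceptional null set is covered by an open set [U] on which the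
   modulus [G] of absolute continuity has small integral; then [f] minus
   [e * (x - a) + int_[a,x] G 1_U] is nonincreasing near every point. *)
Lemma ac_nonincr f a b : a <= b -> ac f a b ->
  {ae mu, forall x, a <= x <= b -> derivable f x 1 /\ 'D_1 f x <= 0} ->
  f b <= f a.
Proof.
move=> ab [G [iG G0 fG]] [N [mN N0 HN]].
(* The linear correction contributes [e * (b - a)], and the integral of [G] over [U] at most [e]. *)
suff H (e : R) : 0 < e -> f b <= f a + e * (b - a + 1).
  apply/ler_addgt0Pr => e e0.
  have ba1 : 0 < b - a + 1 by rewrite ltr_wpDl// subr_ge0.
  rewrite (le_trans (H (e / (b - a + 1)) _)) ?divr_gt0//.
  by rewrite divfK// gt_eqF.
move=> e0.
have [r [r0 Hr]] := integral_normr_continuous iG e0.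
have [|U [oU NU UN]] := lebesgue_regularity_outer mN _ r0.
  by rewrite [X in (X < _)%E]N0.
have mU : measurable U by exact: open_measurable.
have GU : \int[mu]_(x in U) G x <= e.
  apply/ltW; have := Hr U mU.
  under eq_Rintegral => x _ do rewrite ger0_norm//.
  apply.
  rewrite -(setDUK NU) (le_lt_trans (measureU2 mu mN _))//.
    exact: measurableD.
  by rewrite [X in (X + _)%E]N0 add0e.
pose H x := \int[mu]_(x in `[a, x] `&` U) G x.
have H0 x y : a <= x -> x <= y -> H x <= H y.
  move=> ax xy; apply: le_Rintegral_sub => //; try exact: measurableI.
  apply: setSI => z; rewrite /= !in_itv /= => /andP[-> zx].
  exact: le_trans xy.
have HU x y : a <= x -> x <= y -> `[x, y] `<=` U ->
    \int[mu]_(z in `[x, y]) G z <= H y - H x.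
  move=> ax xy xyU; rewrite lerBrDl.
  rewrite -Rintegral_itv_obnd_cbnd; last exact: integrable_sub.
  rewrite -Rintegral_setU//; first last.
  - apply/disj_setPS => z [[]] /=; rewrite !in_itv /= => /andP[_ zx] _.
    by rewrite ltNge zx.
  - by apply: integrable_sub => //; apply: measurableU => //; exact: measurableI.
  - exact: measurableI.
  apply: le_Rintegral_sub => //.
  - by apply: measurableU => //; exact: measurableI.
  - exact: measurableI.
  move=> z [[]|] /=; rewrite !in_itv /=.
    by move=> /andP[-> zx] Uz; split => //; exact: le_trans xy.
  move=> /andP[xz zy]; split; first by rewrite (le_trans ax (ltW xz)).
  by apply: xyU; rewrite /= in_itv /= (ltW xz).
have Hb : H b <= e.
  apply: le_trans GU; apply: le_Rintegral_sub => //; exact: measurableI.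
have Ha : 0 <= H a by apply: Rintegral_ge0.
pose h x := f x - e * x - H x.
have : h b <= h a.
  apply: local_nonincr => // x /andP[ax xb].
  have [Ux|NUx] := pselect (U x).
    have := oU _ Ux => /nbhs_ballP [d d0 xdU]; exists d => // y /andP[ay yb] yx.
    have xdU' z : `|z - x| < d -> U z.
      by move=> zx; apply: xdU; rewrite /ball /= distrC.
    have yxd : - d < y - x < d by rewrite -ltr_norml.
    split=> [lyx|lxy]; rewrite /h.
    - have := fG y x ay lyx xb.
      have := HU y x ay lyx.
      have -> : (`[y, x] `<=` U) = true.
        apply/propext; split => // _ z; rewrite /= in_itv /= => /andP[yz zx].
        by apply: xdU'; rewrite ltr_norml; apply/andP; split; lra.
      move=> /(_ isT) H1; rewrite ler_norml => /andP[_ H2].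
      have : e * y <= e * x by rewrite ler_pM2l.
      lra.
    - have := fG x y ax lxy yb.
      have := HU x y ax lxy.
      have -> : (`[x, y] `<=` U) = true.
        apply/propext; split => // _ z; rewrite /= in_itv /= => /andP[yz zx].
        by apply: xdU'; rewrite ltr_norml; apply/andP; split; lra.
      move=> /(_ isT) H1; rewrite ler_norml => /andP[_ H2].
      have : e * x <= e * y by rewrite ler_pM2l.
      lra.
  have [df dfx] : derivable f x 1 /\ 'D_1 f x <= 0.
    apply: contrapT => nd; apply: NUx; apply: NU; apply: HN => /= hx.
    by apply: nd; apply: hx; rewrite ax xb.
  have : 0 < e by [].
  have := df; rewrite /derivable => /cvg_ex [l Hl].
  have ll : l <= 0 by move/cvg_lim: (Hl) => <-.
  move/cvgrPdist_lt : Hl => /(_ _ e0).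
  rewrite /dnbhs /within /= => /nbhs_ballP[d d0 Hd] _.
  exists d => // y /andP[ay yb] yx.
  have [->|nyx] := eqVneq y x; first by split; rewrite lexx.
  have := Hd (y - x); rewrite /ball /= sub0r normrN => /(_ yx).
  rewrite subr_eq0 => /(_ nyx) /=.
  rewrite !scaler1 subrK /GRing.scale /= => Hq.
  have {}Hq : (y - x)^-1 * (f y - f x) <= e.
    move: Hq; rewrite ltr_norml => /andP[H1 _]; lra.
  split=> [lyx|lxy]; rewrite /h.
  - have Hm := H0 _ _ ay lyx.
    have yx0 : y - x < 0 by rewrite subr_lt0 lt_neqAle nyx.
    have : (y - x) * e <= f y - f x.
      rewrite (_ : f y - f x = (y - x) * ((y - x)^-1 * (f y - f x))).
        by rewrite ler_nM2l.
      by rewrite mulrA mulfV ?mul1r// lt_eqF.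
    lra.
  - have Hm := H0 _ _ ax lxy.
    have yx0 : 0 < y - x by rewrite subr_gt0 lt_neqAle eq_sym nyx.
    have : f y - f x <= (y - x) * e.
      rewrite (_ : f y - f x = (y - x) * ((y - x)^-1 * (f y - f x))).
        by rewrite ler_pM2l.
      by rewrite mulrA mulfV ?mul1r// gt_eqF.
    lra.
rewrite /h; lra.
Qed.

End abs_cont.

(** * Integrals of nonnegative functions and densities *)

Section generic.
Local Open Scope ereal_scope.

Import HBNNSimple.

(* The integral of a nonnegative function is a lower integral, hence it is
   monotone even for nonmeasurable integrands. *)
Lemma le_integral_nonmeas d (T : measurableType d) (R : realType)
    (mu : {measure set T -> \bar R}) (f g : T -> \bar R) :
  (forall x, f x <= g x) -> \int[mu]_x f x <= \int[mu]_x g x.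
Proof.
move=> fg.
have ge0 (u v : T -> \bar R) : (forall x, 0 <= u x) -> (forall x, u x <= v x) ->
    \int[mu]_x u x <= \int[mu]_x v x.
  move=> u0 uv; have v0 x : 0 <= v x by exact: le_trans (uv x).
  rewrite !ge0_integralTE//; apply: le_ereal_sup => _ [h /= hu <-].
  by exists h => // x; exact: le_trans (uv x).
rewrite (integralE _ _ f) (integralE _ _ g); apply: leeB; apply: ge0 => // x.
- by rewrite !funeposE ge_max !le_max fg /= lexx orbT.
- by rewrite !funenegE ge_max !le_max leeN2 fg /= lexx orbT.
Qed.

Section finite_pack.
Context d (T : measurableType d) (R : realType) (n : {measure set T -> \bar R}).
Hypothesis noo : n setT < +oo.

Let finmeas_fin : fin_num_fun n.
Proof.
move=> A mA; rewrite ge0_fin_numE//.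
by rewrite (le_lt_trans _ noo)// le_measure// inE.
Qed.

(** Turns a proof that [n] has finite mass into a canonical finite measure structure, the form in
    which Radon-Nikodym derivatives are available. *)
Definition finmeas of n setT < +oo : set T -> \bar R := n.

HB.instance Definition _ := Measure.copy (finmeas noo) n.
HB.instance Definition _ :=
  Measure_isFinite.Build _ _ _ (finmeas noo) finmeas_fin.

End finite_pack.

(** [rho] equals the Radon-Nikodym derivative of [q] almost everywhere, both having the same
    integral over every measurable set; the change of variables for the derivative then passes to
    [rho]. *)
Lemma integral_density d (T : measurableType d) (R : realType)
    (m q : {measure set T -> \bar R}) (rho : T -> R) :
  m setT < +oo -> q setT < +oo ->
  measurable_fun setT rho -> (forall x, 0 <= rho x)%R ->
  (forall A, measurable A -> q A = \int[m]_(x in A) (rho x)%:E) ->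
  forall f : T -> \bar R, measurable_fun setT f -> (forall x, 0 <= f x) ->
  \int[q]_x f x = \int[m]_x (f x * (rho x)%:E).
Proof.
move=> moo qoo mrho rho0 qE f mf f0.
pose q' : {finite_measure set T -> \bar R} := finmeas qoo.
pose m' : {finite_measure set T -> \bar R} := finmeas moo.
have irho : m'.-integrable setT (EFin \o rho).
  apply/integrableP; split; first exact/measurable_EFinP.
  under eq_integral => x _ do rewrite /= ger0_norm//.
  by rewrite -qE.
have qm : q' `<< m'.
  apply/null_content_dominatesP => A mA mA0; rewrite /= qE//.
  by rewrite null_set_integral//; apply: measurable_funTS; exact/measurable_EFinP.
have -> : \int[q]_x f x = \int[q']_x f x by [].
rewrite -(Radon_Nikodym_SigmaFinite.change_of_variables qm)//.
have ae : ae_eq m' setT (EFin \o rho) (Radon_Nikodym_SigmaFinite.f q' m').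
  apply: integral_ae_eq => //.
    exact: measurable_int (Radon_Nikodym_SigmaFinite.f_integrable qm).
  move=> E _ mE; rewrite -Radon_Nikodym_SigmaFinite.f_integral//.
  by rewrite -[RHS]/(q E) qE.
apply: ge0_ae_eq_integral => //.
- apply: emeasurable_funM => //.
  exact: measurable_int (Radon_Nikodym_SigmaFinite.f_integrable qm).
- by apply: emeasurable_funM => //; exact/measurable_EFinP.
- by move=> x _; rewrite mule_ge0//; exact: Radon_Nikodym_SigmaFinite.f_ge0.
- by move=> x _; rewrite mule_ge0// lee_fin.
- by apply: ae_eqe_mul2l; exact: ae_eq_sym.
Qed.

Lemma bounded_integrable d (T : measurableType d) (R : realType)
    (mu : {measure set T -> \bar R}) (f : T -> R) (M : R) :
  mu setT < +oo -> measurable_fun setT f -> (forall x, `|f x| <= M)%R ->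
  mu.-integrable setT (EFin \o f).
Proof.
move=> moo mf fM; apply: measurable_bounded_integrable => //.
exists M; split; first exact: num_real.
by move=> x Mx t _; rewrite /= (le_trans (fM t))// ltW.
Qed.

End generic.

(** * Bounded Lipschitz functions *)

Section lip_b_theory.
Context {R : realType} {T : ptopologicalType} (d : T -> T -> \bar R).
Hypothesis d0 : forall x y, (0 <= d x y)%E.

Lemma lip_b_cst (c : R) : lip_b d (cst c).
Proof.
split; first exact: cst_continuous.
  by exists `|c| => x.
by exists 0; split => // x y; rewrite subrr normr0 mul0e.
Qed.

Lemma lip_bD f g : lip_b d f -> lip_b d g -> lip_b d (fun x => f x + g x).
Proof.
move=> [cf [Mf fM] [Lf [Lf0 fL]]] [cg [Mg gM] [Lg [Lg0 gL]]]; split.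
- by move=> x; apply: cvgD; [exact: cf|exact: cg].
- by exists (Mf + Mg) => x; rewrite (le_trans (ler_normD _ _))// lerD.
- exists (Lf + Lg); split => [|x y]; first exact: addr_ge0.
  rewrite EFinD ge0_muleDl ?lee_fin//.
  apply: le_trans (leeD (fL x y) (gL x y)); rewrite -EFinD lee_fin.
  rewrite (_ : _ - _ = (f x - f y) + (g x - g y)); last by ring.
  exact: ler_normD.
Qed.

Lemma lip_b_comp (g : R -> R) (k : R) f : 0 <= k ->
  (forall a b, `|g a - g b| <= k * `|a - b|) ->
  lip_b d f -> lip_b d (g \o f).
Proof.
move=> k0 gk [cf [M fM] [L [L0 fL]]].
have cg : continuous g.
  move=> x; apply/cvgrPdist_lt => e e0.
  have k1 : 0 < k + 1 by rewrite ltr_wpDl.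
  near=> t; rewrite (le_lt_trans (gk _ _))//.
  apply: (@le_lt_trans _ _ ((k + 1) * `|x - t|)).
    by rewrite ler_wpM2r// lerDl.
  rewrite mulrC -ltr_pdivlMr//; near: t.
  by apply: cvgr_dist_lt; rewrite ?divr_gt0.
split.
- by move=> x; apply: continuous_comp; [exact: cf|exact: cg].
- exists (`|g 0| + k * M) => x /=.
  have -> : g (f x) = g 0 + (g (f x) - g 0) by ring.
  rewrite (le_trans (ler_normD _ _))// lerD2l (le_trans (gk _ _))// subr0.
  by rewrite ler_wpM2l.
- exists (k * L); split => [|x y]; first exact: mulr_ge0.
  apply: (@le_trans _ _ (k%:E * `|f x - f y|%:E)%E).
    by rewrite -EFinM lee_fin; exact: gk.
  by rewrite EFinM -muleA; apply: lee_wpmul2l; rewrite ?lee_fin.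
Unshelve. all: by end_near. Qed.

Lemma lip_bZ (c : R) f : lip_b d f -> lip_b d (fun x => c * f x).
Proof.
apply: (@lip_b_comp ( *%R c) `|c|) => // a b.
by rewrite -mulrBr normrM.
Qed.

Lemma lip_b_sum (I : Type) (s : seq I) (fs : I -> T -> R) :
  (forall i, lip_b d (fs i)) -> lip_b d (fun x => \sum_(i <- s) fs i x).
Proof.
move=> H; elim: s => [|i s IH].
  have -> : (fun x => \sum_(i <- [::]) fs i x) = cst 0.
    by apply/funext => x; rewrite big_nil.
  exact: lip_b_cst.
have -> : (fun x => \sum_(j <- i :: s) fs j x) =
    (fun x => fs i x + \sum_(j <- s) fs j x).
  by apply/funext => x; rewrite big_cons.
exact: lip_bD.
Qed.

Definition clip (a b x : R) := Num.max a (Num.min x b).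

Lemma clip_itv a b x : a <= b -> a <= clip a b x <= b.
Proof.
move=> ab; rewrite /clip; apply/andP; split; first by rewrite le_max lexx.
by rewrite ge_max ab ge_min lexx orbT.
Qed.

Lemma clip_id a b x : a <= x <= b -> clip a b x = x.
Proof.
move=> /andP[ax xb]; rewrite /clip (min_idPl _)//.
by apply/max_idPr.
Qed.

Lemma clip_dist a b x y : `|clip a b x - clip a b y| <= `|x - y|.
Proof.
wlog xy : x y / x <= y.
  move=> H; have [/H//|/ltW/H] := leP x y.
  by rewrite distrC (distrC y).
rewrite (ler0_norm (_ : x - y <= 0)) ?subr_le0//.
rewrite /clip; case: (leP x b) => ?; case: (leP y b) => ?;
  case: (leP a _) => ?; try (case: (leP a _) => ?);
  rewrite ler_norml; apply/andP; split; lra.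
Qed.

Lemma lip_b_clip (a b : R) f : lip_b d f -> lip_b d (clip a b \o f).
Proof.
by apply: (@lip_b_comp _ 1) => // x y; rewrite mul1r; exact: clip_dist.
Qed.

Lemma lip_b_dist (a : R) f : lip_b d f -> lip_b d (fun x => `|f x - a|).
Proof.
apply: (@lip_b_comp (fun x => `|x - a|) 1) => // x y; rewrite mul1r.
rewrite (le_trans (ler_dist_dist _ _))//.
by rewrite (_ : _ - _ = x - y)//; ring.
Qed.

End lip_b_theory.

Section emt_theory.
Context {R : realType} {T : ptopologicalType} (d : T -> T -> \bar R).
Hypothesis emtd : emt_space d.

Let d0 x y : (0 <= d x y)%E.
Proof. by case: emtd => _ [/(_ x y)]. Qed.

(** The initial topology gives finitely many [fs i] and [e] such that outside [U] some
    [|fs i y - fs i x|] is at least [e]. There the sum of these terms is at least [e] too, so [v] is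
    nonpositive and is clipped to 0. *)
Lemma emt_bump (U : set T) (x : T) : open U -> U x ->
  exists u : T -> R, [/\ lip_b d u, forall y, 0 <= u y <= 1, u x = 1 &
    forall y, ~ U y -> u y = 0].
Proof.
move=> oU Ux; case: emtd => _ _ /(_ _ oU _ Ux)[n [fs [e [e0 fsL H]]]] _.
pose v y := 1 + (- e^-1) * \sum_(i <- enum 'I_n) `|fs i y - fs i x|.
exists (clip 0 1 \o v); split.
- apply: lip_b_clip => //; apply: lip_bD => //; first exact: lip_b_cst.
  by apply: lip_bZ => //; apply: lip_b_sum => // i; exact: lip_b_dist.
- by move=> y; exact: clip_itv.
- rewrite /= /v big1 ?mulr0 ?addr0 ?clip_id ?lexx ?ler01//.
  by move=> i _; rewrite subrr normr0.
- move=> y NUy; rewrite /= /clip; apply/max_idPl.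
  rewrite ge_min; apply/orP; left.
  have [i /negP] : exists i, ~ `|fs i y - fs i x| < e.
    by apply/existsNP => h; apply: NUy; exact: H.
  rewrite -leNgt => ei.
  rewrite /v mulNr subr_le0 ler_pdivlMl// mulr1 (le_trans ei)//.
  by rewrite big_enum/= (bigD1 i)//= lerDl sumr_ge0.
Qed.

(** Bumps centred at the points of [K] and vanishing on [C] exceed 1/2 on open sets that cover [K].
    Twice the sum over a finite subcover is at least 1 on [K], still 0 on [C], and is clipped. *)
Lemma emt_separation (K C : set T) : compact K -> compact C -> K `&` C = set0 ->
  exists f : T -> R, [/\ lip_b d f, forall y, 0 <= f y <= 1,
    forall y, K y -> f y = 1 & forall y, C y -> f y = 0].
Proof.
move=> cK cC KC0.
have hT : hausdorff_space T by case: emtd.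
have oC : open (~` C) by apply: closed_openC; exact: compact_closed.
have KC x : K x -> (~` C) x by move=> Kx Cx; suff : set0 x by []; rewrite -KC0.
have /choice [u Hu] (x : T) : exists u : T -> R, [/\ lip_b d u,
    forall y, 0 <= u y <= 1, (K x -> u x = 1) & forall y, C y -> u y = 0].
  have [Kx|NKx] := pselect (K x).
    have [u [u1 u2 u3 u4]] := emt_bump oC (KC _ Kx).
    by exists u; split => // y Cy; apply: u4 => /(_ Cy).
  by exists (cst 0); split => //; [exact: lip_b_cst|move=> y; rewrite lexx ler01].
have oV x : open [set y | 2^-1 < u x y].
  have [[cu _ _] _ _ _] := Hu x.
  apply: (@open_comp _ _ (u x) [set r | 2^-1 < r]) => [y _|].
    exact: cu.
  exact: open_gt.
move: cK; rewrite compact_cover => /(_ T K (fun x => [set y | 2^-1 < u x y])).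
case=> [x _|y Ky|D' D'K KD']; first exact: oV.
  exists y => //=; have [_ _ -> //] := Hu y.
  by rewrite invf_lt1 ?ltr1n.
exists (clip 0 1 \o (fun y => 2 * \sum_(x <- finmap.enum_fset D') u x y)); split.
- apply: lip_b_clip => //; apply: lip_bZ => //; apply: lip_b_sum => // x.
  by have [] := Hu x.
- by move=> y; exact: clip_itv.
- move=> y Ky; have [x /= xD' uxy] := KD' _ Ky.
  rewrite /= /clip (min_idPr _) ?(max_idPr _) ?ler01//.
  rewrite (big_rem x)//=.
  have : 0 <= \sum_(z <- rem x (finmap.enum_fset D')) u z y.
    by apply: sumr_ge0 => z _; have [_ /(_ y)/andP[]] := Hu z.
  lra.
- move=> y Cy; rewrite /= big1 ?mulr0 ?clip_id ?lexx ?ler01//.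
  by move=> x _; have [_ _ _ ->] := Hu x.
Qed.

End emt_theory.

(** * Approximation in L1 of Radon measures *)

Section borel_theory.
Context {R : realType}.

Lemma open_borel (T : ptopologicalType) (U : set T) :
  open U -> measurable (U : set (borel T)).
Proof. by move=> oU; exact: sub_sigma_algebra. Qed.

Lemma compact_borel (T : ptopologicalType) (K : set T) :
  hausdorff_space T -> compact K -> measurable (K : set (borel T)).
Proof.
move=> hT cK; rewrite -[K]setCK; apply: measurableC; apply: open_borel.
by apply: closed_openC; exact: compact_closed.
Qed.

(** Couplings live on the Borel sets of the product topology rather than on a product sigma-algebra,
    so the projections are measurable because they are continuous. *)
Lemma continuous_borel (S T : ptopologicalType) (g : S -> T) :
  continuous g -> measurable_fun (setT : set (borel S)) (g : borel S -> borel T).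
Proof.
move=> /continuousP cg.
apply: (@measurability _ _ (borel S) (borel T) setT g (@open T)) => //.
by move=> _ [U oU <-]; rewrite setTI; apply: open_borel; exact: cg.
Qed.

Lemma continuous_borel_fun (T : ptopologicalType) (f : T -> R) :
  continuous f -> measurable_fun (setT : set (borel T)) f.
Proof.
move=> /continuousP cf; apply: (measurability _ (RGenOInfty.measurableE R)) => //.
move=> _ [_ [a ->] <-]; rewrite setTI; apply: open_borel; apply: cf.
by rewrite set_itvE; exact: open_gt.
Qed.

End borel_theory.

Section approximation.
Context {R : realType} {T : ptopologicalType} (d : T -> T -> \bar R).
Hypothesis emtd : emt_space d.
Implicit Type la : {measure set (borel T) -> \bar R}.
Local Open Scope ereal_scope.

Let d0 x y : 0 <= d x y.
Proof. by case: emtd => _ [/(_ x y)]. Qed.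

(** Difference form of Radon regularity: it passes to a sum of two measures by taking the union of
    two compact sets, and is later applied to the sum of [m] and [b]. *)
Definition inner_regular la := forall A : set (borel T), measurable A ->
  forall e : R, (0 < e)%R ->
  exists K : set T, [/\ compact K, K `<=` A & la (A `\` K) < e%:E].

Lemma radon_inner_regular la : radon la -> inner_regular la.
Proof.
have hT : hausdorff_space T by case: emtd.
move=> [lafin laE] A mA e e0.
have fA : la A < +oo.
  by rewrite (le_lt_trans _ lafin)// le_measure// inE.
have : la A - e%:E < la A by rewrite lteBlDr// lteDl ?lte_fin// ge0_fin_numE.
rewrite {2}laE// => /ereal_sup_gt [_ [K [cK KA] <-]] lK.
have mK := compact_borel hT cK.
exists K; split => //; rewrite measureD// (setIidr KA).
rewrite lteBlDr ?ge0_fin_numE//; last first.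
  by rewrite (le_lt_trans _ fA)// le_measure// inE.
by rewrite addeC -lteBlDr.
Qed.

Lemma inner_regularD la1 la2 : inner_regular la1 -> inner_regular la2 ->
  inner_regular (measure_add la1 la2).
Proof.
have hT : hausdorff_space T by case: emtd.
move=> r1 r2 A mA e e0.
have e20 : (0 < e / 2)%R by rewrite divr_gt0.
have [K1 [cK1 K1A lK1]] := r1 A mA _ e20.
have [K2 [cK2 K2A lK2]] := r2 A mA _ e20.
exists (K1 `|` K2); split.
- exact: compactU.
- by rewrite subUset.
- have mK1 := compact_borel hT cK1; have mK2 := compact_borel hT cK2.
  rewrite [ltLHS](measure_addE la1 la2) (splitr e) EFinD.
  apply: lteD; [apply: le_lt_trans lK1|apply: le_lt_trans lK2];
    apply: le_measure; rewrite ?inE;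
    try (by apply: measurableD => //; exact: measurableU);
    try exact: measurableD; apply: setDS => x Kx; by [left|right].
Qed.

Definition approximable la (phi : T -> R) :=
  measurable_fun (setT : set (borel T)) phi /\
  forall e : R, (0 < e)%R -> exists2 f : T -> R, lip_b d f &
    \int[la]_x (`|phi x - f x|)%:E <= e%:E.

Lemma lip_b_borel (f : T -> R) :
  lip_b d f -> measurable_fun (setT : set (borel T)) f.
Proof. by case=> cf _ _; exact: continuous_borel_fun. Qed.

Lemma measurable_distr (f g : T -> R) : measurable_fun (setT : set (borel T)) f ->
  measurable_fun (setT : set (borel T)) g ->
  measurable_fun (setT : set (borel T)) (fun x => (`|f x - g x|)%:E).
Proof.
move=> mf mg; apply/measurable_EFinP.
by apply: measurableT_comp => //; exact: measurable_funB.
Qed.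

Lemma approximableD la phi psi : approximable la phi -> approximable la psi ->
  approximable la (fun x => phi x + psi x)%R.
Proof.
move=> [mphi aphi] [mpsi apsi]; split; first exact: measurable_funD.
move=> e e0; have e20 : (0 < e / 2)%R by rewrite divr_gt0.
have [f Lf hf] := aphi _ e20; have [g Lg hg] := apsi _ e20.
have mf := lip_b_borel Lf; have mg := lip_b_borel Lg.
exists (fun x => f x + g x)%R; first exact: lip_bD.
apply: (@le_trans _ _ (\int[la]_x ((`|phi x - f x|)%:E + (`|psi x - g x|)%:E))).
  apply: le_integral_nonmeas => x; rewrite -EFinD lee_fin.
  rewrite (_ : _ - _ = (phi x - f x) + (psi x - g x))%R; last by ring.
  exact: ler_normD.
rewrite ge0_integralD//.
- by rewrite (splitr e) EFinD leeD.
- exact: measurable_distr.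
- exact: measurable_distr.
Qed.

Lemma approximableZ la phi (c : R) : approximable la phi ->
  approximable la (fun x => c * phi x)%R.
Proof.
move=> [mphi aphi]; split; first exact: measurable_funM.
move=> e e0; have c0 : (0 < `|c| + 1)%R by rewrite ltr_wpDl.
have e20 : (0 < e / (`|c| + 1))%R by rewrite divr_gt0.
have [f Lf hf] := aphi _ e20; have mf := lip_b_borel Lf.
exists (fun x => c * f x)%R; first exact: lip_bZ.
rewrite (eq_integral (fun x : borel T => `|c|%:E * (`|phi x - f x|)%:E)); last first.
  by move=> x _; rewrite -mulrBr normrM EFinM.
rewrite ge0_integralZl_EFin//; last exact: measurable_distr.
apply: (@le_trans _ _ (`|c|%:E * (e / (`|c| + 1))%:E)).
  by apply: lee_wpmul2l.
rewrite -EFinM lee_fin mulrA ler_pdivrMr// mulrC ler_pM2l//.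
by rewrite lerDl.
Qed.

Lemma approximable_sum la (I : Type) (s : seq I) (phi : I -> T -> R) :
  (forall i, approximable la (phi i)) ->
  approximable la (fun x => \sum_(i <- s) phi i x)%R.
Proof.
move=> H; elim: s => [|i s IH].
  have -> : (fun x => \sum_(i <- [::]) phi i x)%R = cst 0%R.
    by apply/funext => x; rewrite big_nil.
  split => // e e0; exists (cst 0%R); first exact: lip_b_cst.
  by rewrite integral0_eq ?lee_fin ?ltW// => x _; rewrite subrr normr0.
have -> : (fun x => \sum_(j <- i :: s) phi j x)%R =
    (fun x => phi i x + \sum_(j <- s) phi j x)%R.
  by apply/funext => x; rewrite big_cons.
exact: approximableD.
Qed.

(** Compact sets exhaust [A] and its complement up to mass [e / 2] each. A Lipschitz function
    separating them equals the indicator on both and differs from it by at most 1 elsewhere. *)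
Lemma approximable_indic la (A : set (borel T)) : inner_regular la ->
  measurable A -> approximable la \1_A.
Proof.
have hT : hausdorff_space T by case: emtd.
move=> rla mA; split; first exact: measurable_indic.
move=> e e0; have e20 : (0 < e / 2)%R by rewrite divr_gt0.
have [K [cK KA lK]] := rla A mA _ e20.
have [C [cC CA lC]] := rla (~` A) (measurableC mA) _ e20.
have mK := compact_borel hT cK; have mC := compact_borel hT cC.
have [//|//||f [Lf f01 fK fC]] := @emt_separation _ _ d emtd K C.
  by apply/seteqP; split => // x [/KA Ax /CA].
exists f => //.
have mD : measurable ((A `\` K) `|` (~` A `\` C)).
  by apply: measurableU; apply: measurableD => //; exact: measurableC.
apply: (@le_trans _ _ (\int[la]_x (\1_((A `\` K) `|` (~` A `\` C)) x)%:E)).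
  apply: le_integral_nonmeas => x; rewrite lee_fin !indicE.
  have [Ax|NAx] := pselect (A x).
  - rewrite (mem_set Ax); have [Kx|NKx] := pselect (K x).
      by rewrite fK// subrr normr0.
    rewrite mem_set; last by left.
    by have /andP[? ?] := f01 x; rewrite ler_norml; apply/andP; split; rewrite /=; lra.
  - rewrite (memNset NAx); have [Cx|NCx] := pselect (C x).
      by rewrite fC// subrr normr0.
    rewrite mem_set; last by right.
    by have /andP[? ?] := f01 x; rewrite ler_norml; apply/andP; split; rewrite /=; lra.
rewrite integral_indic// setIT (splitr e) EFinD.
apply: (le_trans (measureU2 _ _ _)).
- exact: measurableD.
- by apply: measurableD => //; exact: measurableC.
- by apply: leeD; exact: ltW.
Qed.

Import HBSimple.

Lemma approximable_bounded la (phi : T -> R) (M : R) :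
  la setT < +oo -> inner_regular la ->
  measurable_fun (setT : set (borel T)) phi -> (forall x, `|phi x| <= M)%R ->
  forall e : R, (0 < e)%R -> exists f : T -> R, [/\ lip_b d f,
    (forall x, `|f x| <= M)%R & \int[la]_x (`|phi x - f x|)%:E <= e%:E].
Proof.
move=> lafin rla mphi phiM e e0; have e20 : (0 < e / 2)%R by rewrite divr_gt0.
have iphi : la.-integrable setT (EFin \o phi).
  exact: (bounded_integrable lafin mphi phiM).
have [g [ig _ gphi]] := approximation_sfun_integrable measurableT iphi.
have [n gn] : exists n, \int[la]_x (`|phi x - g n x|)%:E <= (e / 2)%:E.
  move/fine_cvgP : gphi => [fing /cvgrPdist_lt/(_ _ e20) ge].
  have [n _ /(_ n (leqnn n)) [fn]] := filterI fing ge.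
  rewrite /= sub0r normrN => h; exists n.
  have ig0 : 0 <= \int[la]_x (`|phi x - g n x|)%:E by exact: integral_ge0.
  rewrite -[leLHS]fineK// lee_fin ltW//.
  by move: h; rewrite ger0_norm// fine_ge0.
have [_ /(_ _ e20)[f Lf hf]] : approximable la (g n).
  rewrite [X in approximable _ X](funext (fimfunEord (g n))).
  apply: approximable_sum => i; apply: approximableZ; apply: approximable_indic => //.
have mf := lip_b_borel Lf.
have M0 : (0 <= M)%R by apply: le_trans (phiM point).
(* Clipping is 1-Lipschitz and fixes [phi], so the error does not grow. The bound [M] is kept
   because the exponential is Lipschitz only on bounded sets. *)
exists (clip (- M) M \o f); split.
- exact: lip_b_clip.
- by move=> x; rewrite ler_norml; apply: clip_itv; lra.
- apply: (@le_trans _ _ (\int[la]_x ((`|phi x - g n x|)%:E + (`|g n x - f x|)%:E))).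
    apply: le_integral_nonmeas => x; rewrite -EFinD lee_fin.
    have {1}<- : clip (- M)%R M (phi x) = phi x by rewrite clip_id// -ler_norml.
    rewrite (le_trans (clip_dist _ _ _ _))//.
    rewrite (_ : _ - _ = (phi x - g n x) + (g n x - f x))%R; last by ring.
    exact: ler_normD.
  rewrite ge0_integralD//.
  + by rewrite (splitr e) EFinD leeD.
  + exact: measurable_distr.
  + exact: measurable_distr.
Qed.

End approximation.

(** * Duality for the entropy *)

Section entropy_duality.
Context {R : realType} {X : ptopologicalType}.
Variable m : {measure set (borel X) -> \bar R}.
Hypothesis m1 : m setT = 1%E.
Implicit Type q : {measure set (borel X) -> \bar R}.

Let moo : (m setT < +oo)%E. Proof. by rewrite m1 ltry. Qed.

(** Fenchel dual functional: [expR] is the conjugate of [s * ln s - s], and the [1] is the integral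
    of the density of [q]. *)
Definition Ent_dual q (phi : X -> R) : R :=
  (\int[q]_x phi x + 1 - \int[m]_x expR (phi x)).

Lemma density_integrable q rho : q setT = 1%E -> is_density m q rho ->
  m.-integrable setT (EFin \o rho).
Proof.
move=> q1 [mrho rho0 qE]; apply/integrableP; split; first exact/measurable_EFinP.
under eq_integral => x _ do rewrite /= ger0_norm//.
by rewrite -qE// q1 ltry.
Qed.

Lemma density_Rintegral q rho (phi : X -> R) (M : R) :
  q setT = 1%E -> is_density m q rho ->
  measurable_fun (setT : set (borel X)) phi -> (forall x, `|phi x| <= M) ->
  m.-integrable setT (EFin \o (fun x => phi x * rho x)) /\
  \int[q]_x phi x = \int[m]_x (phi x * rho x).
Proof.
move=> q1 dens mphi phiM; have irho := density_integrable q1 dens.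
case: dens => mrho rho0 qE.
have M0 : 0 <= M by apply: le_trans (phiM point).
have iZ : m.-integrable setT (EFin \o (fun x => M * rho x)).
  rewrite (_ : EFin \o _ = fun x => (M%:E * (rho x)%:E)%E) //.
  exact: integrableZl.
have ip : m.-integrable setT (EFin \o (fun x => phi x * rho x)).
  apply: le_integrable iZ => //.
    by apply/measurable_EFinP; exact: measurable_funM.
  move=> x _; rewrite /= lee_fin !normrM ler_wpM2r//.
  by rewrite (ger0_norm M0).
split => //.
have iphi : q.-integrable setT (EFin \o phi).
  by apply: (bounded_integrable _ mphi phiM); rewrite q1 ltry.
have qoo : (q setT < +oo)%E by rewrite q1 ltry.
have ic : q.-integrable setT (EFin \o (fun=> M)).
  by apply: (@bounded_integrable _ _ _ q _ `|M|).
(* Shifting by [M] makes the integrand nonnegative, as [integral_density] requires; the shift adds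
   [M] to both sides since [q] has mass 1. *)
have : \int[q]_x (phi x + M) = \int[m]_x (phi x * rho x + M * rho x).
  congr fine.
  rewrite (integral_density moo qoo mrho rho0 qE).
  - by apply: eq_integral => x _; rewrite -EFinM mulrDl.
  - by apply/measurable_EFinP; exact: measurable_funD.
  - move=> x; rewrite lee_fin.
    by have := phiM x; rewrite ler_norml => /andP[? _]; lra.
rewrite RintegralD// RintegralD// RintegralZl// Rintegral_cst//.
have -> : \int[m]_x rho x = 1 by rewrite /Rintegral -qE// q1.
by rewrite q1 mulr1 => /addIr.
Qed.

(** Young inequality of this conjugate pair: for [s > 0] it is [1 + u <= expR u] at [u = p - ln s],
    multiplied by [s]. *)
Lemma xlnx_dual (s p : R) : 0 <= s -> p * s + s - expR p <= s * ln s.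
Proof.
rewrite le_eqVlt => /predU1P[<-|s0].
  by rewrite !(mulr0,mul0r) !add0r oppr_le0 expR_ge0.
have := expR_ge1Dx (p - ln s); rewrite expRD expRN lnK ?posrE// => h.
have {}h : s * (1 + (p - ln s)) <= s * (expR p / s) by rewrite ler_pM2l.
have es : s * (expR p / s) = expR p by rewrite mulrCA mulfV ?mulr1// gt_eqF.
rewrite es in h; lra.
Qed.

Lemma Ent_dual_le q (phi : X -> R) (M : R) : q setT = 1%E ->
  measurable_fun (setT : set (borel X)) phi -> (forall x, `|phi x| <= M) ->
  ((Ent_dual q phi)%:E <= Ent m q)%E.
Proof.
move=> q1 mphi phiM; rewrite /Ent; case: pselect => [h|_]; last exact: leey.
case: (cid h) => rho /= dens.
have irho := density_integrable q1 dens.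
have [ip E1] := density_Rintegral q1 dens mphi phiM.
rewrite /Ent_dual E1.
have rho0 : forall x, 0 <= rho x by case: dens.
have ie : m.-integrable setT (EFin \o (fun x => expR (phi x))).
  apply: (@bounded_integrable _ _ _ m _ (expR M)) => //.
    exact: measurableT_comp.
  move=> x; rewrite ger0_norm ?expR_ge0// ler_expR.
  by apply: le_trans (phiM x); exact: ler_norm.
have ipr : m.-integrable setT (EFin \o (fun x => phi x * rho x + rho x)).
  rewrite (_ : EFin \o _ = fun x => ((phi x * rho x)%:E + (rho x)%:E)%E) //.
  exact: integrableD.
have ia : m.-integrable setT (EFin \o (fun x => phi x * rho x + rho x - expR (phi x))).
  rewrite (_ : EFin \o _ =
    fun x => ((phi x * rho x + rho x)%:E - (expR (phi x))%:E)%E) //.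
  exact: integrableB.
have rho1 : \int[m]_x rho x = 1.
  by case: dens => _ _ qE; rewrite /Rintegral -qE// q1.
have -> : \int[m]_x (phi x * rho x) + 1 - \int[m]_x expR (phi x) =
    \int[m]_x (phi x * rho x + rho x - expR (phi x)).
  by rewrite RintegralB// RintegralD// rho1.
rewrite /Rintegral fineK; last exact: integrable_fin_num.
by apply: le_integral_nonmeas => x; rewrite lee_fin; exact: xlnx_dual.
Qed.

(** At [phi = 0] the dual functional vanishes, [m] having mass 1. *)
Lemma Ent_ge0 q : q setT = 1%E -> (0 <= Ent m q)%E.
Proof.
move=> q1; apply: le_trans (@Ent_dual_le q (cst 0) 0 q1 _ _) => //.
  rewrite /Ent_dual lee_fin.
  under [X in _ - X]eq_Rintegral do rewrite /= expR0.
  by rewrite !Rintegral_cst// m1 !(mul0r, mul1r) add0r subrr.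
by move=> x; rewrite normr0.
Qed.

(** For [r > 0] the clipping is eventually inactive; at [r = 0] the error is exactly
    [n.+1%:R^-1]. *)
Lemma ln_clip_cvg (r : R) : 0 <= r ->
  ln (clip n.+1%:R^-1 n.+1%:R r) * r + 1 - clip n.+1%:R^-1 n.+1%:R r
    @[n --> \oo] --> r * ln r + 1 - r.
Proof.
rewrite le_eqVlt => /predU1P[<-|r0]; apply/cvgrPdist_le => e e0; near=> n;
  have n0 : 0 < n.+1%:R :> R by rewrite ltr0n.
- have ne : n.+1%:R^-1 <= e.
    by apply: ltW; near: n; exact: near_infty_natSinv_lt (PosNum e0).
  rewrite mul0r mulr0 !add0r subr0 opprB addrCA subrr addr0.
  rewrite /clip (min_idPl _) ?(ltW n0)// (max_idPl _) ?invr_ge0 ?(ltW n0)//.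
  by rewrite ger0_norm// invr_ge0 ltW.
- have nr : r <= n.+1%:R.
    by apply: (@le_trans _ _ n%:R); [near: n; exact: nbhs_infty_ger|rewrite ler_nat].
  rewrite clip_id; first by rewrite (mulrC r) subrr normr0 ltW.
  rewrite nr andbT; apply: ltW.
  by near: n; exact: near_infty_natSinv_lt (PosNum r0).
Unshelve. all: by end_near. Qed.

(** The clipping interval contains 1, so for [r > 0] clipping moves [r] towards 1 and can only
    decrease [|ln r|]. The remaining terms are controlled since the clipped value lies between 0 and
    [r + 1]. *)
Lemma ln_clip_bound (n : nat) (r : R) : 0 <= r ->
  `|ln (clip n.+1%:R^-1 n.+1%:R r) * r + 1 - clip n.+1%:R^-1 n.+1%:R r| <=
  `|r * ln r| + r + 2.
Proof.
move=> r0; have n0 : 0 < n.+1%:R :> R by rewrite ltr0n.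
have n1 : 1 <= n.+1%:R :> R by rewrite ler1n.
have i0 : 0 < n.+1%:R^-1 :> R by rewrite invr_gt0.
have i1 : n.+1%:R^-1 <= 1 :> R by rewrite invf_le1.
have ab := le_trans i1 n1.
have [c1 c2] := andP (clip_itv r ab).
have c3 : clip n.+1%:R^-1 n.+1%:R r <= r + 1.
  rewrite /clip ge_max ge_min lerDl ler01 andbT.
  by rewrite (le_trans i1)// lerDr.
have c4 := lt_le_trans i0 c1.
suff H : `|ln (clip n.+1%:R^-1 n.+1%:R r) * r| <= `|r * ln r|.
  move: H; set u := _ * r; set v := r * _; set w := clip _ _ _ in c1 c2 c3 c4 *.
  move=> H; clear c1 c2; rewrite (_ : u + 1 - w = u + (1 - w)); last by ring.
  rewrite (le_trans (ler_normD _ _))// -addrA lerD//.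
  by rewrite ler_norml; apply/andP; split; lra.
move: r0; rewrite le_eqVlt => /predU1P[<-|r0]; first by rewrite mulr0 mul0r.
rewrite (mulrC r) !normrM ler_wpM2r//.
have [rn|nr] := leP r n.+1%:R; last first.
  rewrite /clip (min_idPr _) ?(ltW nr)// (max_idPr _)// !ger0_norm ?ln_ge0//; last first.
    by rewrite (le_trans n1)// ltW.
  by rewrite ler_ln ?posrE// ltW.
have [ri|ir] := leP n.+1%:R^-1 r; first by rewrite clip_id ?ri.
rewrite /clip (min_idPl _)// (max_idPl _) ?(ltW ir)// !ler0_norm ?ln_le0//; last first.
  by rewrite (le_trans (ltW ir)).
by rewrite lerN2 ler_ln ?posrE// ltW.
Qed.

(** The formal maximizer [ln rho] is unbounded; the logarithms of the clipped densities are bounded,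
    and their dual values converge to the entropy by dominated convergence. *)
Lemma Ent_dual_approx q (c : R) : q setT = 1%E -> (Ent m q < +oo)%E ->
  (c%:E < Ent m q)%E -> exists (phi : X -> R) (M : R),
  [/\ measurable_fun (setT : set (borel X)) phi,
      forall x, `|phi x| <= M & c < Ent_dual q phi].
Proof.
move=> q1; have := Ent_ge0 q1; rewrite /Ent; case: pselect => [h|//].
case: (cid h) => rho /= dens Ege0 Eoo cE.
have irho := density_integrable q1 dens.
have [mrho rho0 qE] := dens.
have rho1 : (\int[m]_x (rho x)%:E = 1)%E by rewrite -qE// q1.
have mln : measurable_fun (setT : set (borel X)) (fun x => rho x * ln (rho x)).
  by apply: measurable_funM => //; exact: measurableT_comp.
(* Finiteness of the entropy enters here: [rho * ln rho] becomes integrable and can serve in the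
   dominating function. *)
have iln : m.-integrable setT (EFin \o (fun x => rho x * ln (rho x))).
  apply/integrableP; split; first exact/measurable_EFinP.
  by rewrite integral_fin_num_abs// ge0_fin_numE.
pose k n x := clip n.+1%:R^-1 n.+1%:R (rho x).
have mk n : measurable_fun (setT : set (borel X)) (k n).
  by apply: measurable_maxr => //; exact: measurable_minr.
have ab n : n.+1%:R^-1 <= n.+1%:R :> R.
  by rewrite (@le_trans _ _ 1) ?ler1n// invf_le1 ?ler1n ?ltr0n.
have k0 n x : 0 < k n x.
  have /andP[+ _] := clip_itv (rho x) (ab n).
  by apply: lt_le_trans; rewrite invr_gt0 ltr0n.
pose phi n x := ln (k n x).
have mphi n : measurable_fun (setT : set (borel X)) (phi n).
  exact: measurableT_comp.
have phiM n x : `|phi n x| <= ln n.+1%:R.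
  have /andP[k1 k2] := clip_itv (rho x) (ab n).
  rewrite ler_norml /phi -lnV ?posrE ?ltr0n//.
  by rewrite !ler_ln ?posrE ?ltr0n ?invr_gt0 ?ltr0n// k1 k2.
pose F n x := phi n x * rho x + 1 - k n x.
have i1 : m.-integrable setT (EFin \o (fun=> 1 : R)).
  by apply: (@bounded_integrable _ _ _ m _ `|1|).
have ik n : m.-integrable setT (EFin \o k n).
  apply: (@bounded_integrable _ _ _ m _ n.+1%:R) => // x.
  by rewrite (ger0_norm (ltW (k0 _ _))); have /andP[] := clip_itv (rho x) (ab n).
have dualE n : (Ent_dual q (phi n))%:E = (\int[m]_x (F n x)%:E)%E.
  have [ip E1] := density_Rintegral q1 dens (mphi n) (phiM n).
  have ip1 : m.-integrable setT (EFin \o (fun x => phi n x * rho x + 1)).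
    rewrite (_ : EFin \o _ = fun x => ((phi n x * rho x)%:E + 1%:E)%E) //.
    exact: integrableD.
  have iF : m.-integrable setT (EFin \o F n).
    rewrite (_ : EFin \o _ = fun x => ((phi n x * rho x + 1)%:E - (k n x)%:E)%E) //.
    by apply: integrableB => //; exact: ik.
  rewrite -[RHS]fineK; last exact: integrable_fin_num iF.
  congr EFin; rewrite -[RHS]/(\int[m]_x F n x) /F RintegralB// RintegralD//.
  rewrite Rintegral_cst// m1 mul1r /Ent_dual E1; congr (_ - _).
  by apply: eq_Rintegral => x _; rewrite /phi lnK// posrE.
(* [rho] and 1 have the same integral, so the pointwise limit [G] still integrates to the
   entropy. *)
pose G x := rho x * ln (rho x) + 1 - rho x.
have EG : (\int[m]_x (rho x * ln (rho x))%:E = \int[m]_x (G x)%:E)%E.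
  have ip1 : m.-integrable setT (EFin \o (fun x => rho x * ln (rho x) + 1)).
    rewrite (_ : EFin \o _ = fun x => ((rho x * ln (rho x))%:E + 1%:E)%E) //.
    exact: integrableD.
  have -> : (fun x => (G x)%:E) =
    (fun x => ((rho x * ln (rho x) + 1)%:E - (rho x)%:E)%E) by [].
  rewrite integralB// rho1.
  have -> : (fun x => (rho x * ln (rho x) + 1)%:E) =
    (fun x => ((rho x * ln (rho x))%:E + 1%:E)%E) by [].
  rewrite integralD// integral_cst// m1 mul1e addeK//.
have [_ _ cvgF] : [/\ m.-integrable setT (EFin \o G),
  [sequence \int[m]_x `|(F n x)%:E - (G x)%:E|]_n @ \oo --> 0%E &
  [sequence \int[m]_x (F n x)%:E]_n @ \oo --> (\int[m]_x (G x)%:E)]%E.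
  apply: (@dominated_convergence _ _ _ m setT measurableT
     (fun n => EFin \o F n) (EFin \o G)
     (fun x => (`|rho x * ln (rho x)| + rho x + 2)%:E)).
  - move=> n; apply/measurable_EFinP; apply: measurable_funB => //.
    by apply: measurable_funD => //; exact: measurable_funM.
  - apply/measurable_EFinP; apply: measurable_funB => //.
    exact: measurable_funD.
  - apply: aeW => x _ /=; apply: cvg_EFin; first exact: nearW.
    exact: ln_clip_cvg.
  - have -> : (fun x => (`|rho x * ln (rho x)| + rho x + 2)%:E) =
      (fun x => ((`|rho x * ln (rho x)|)%:E + (rho x)%:E + 2%:E)%E) by [].
    apply: integrableD => //.
      apply: integrableD => //; exact: integrable_abse iln.
    by apply: (@bounded_integrable _ _ _ m _ `|2|).
  - by apply: aeW => x n _; rewrite /= lee_fin; exact: ln_clip_bound.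
have [n cn] : exists n, (c%:E < \int[m]_x (F n x)%:E)%E.
  apply: contrapT => /forallNP Hn; move: cE; rewrite EG ltNge => /negP; apply.
  rewrite -(cvg_lim _ cvgF)//; apply: lime_le.
    by apply/cvg_ex; eexists; exact: cvgF.
  by apply: nearW => n; rewrite leNgt; apply/negP; exact: Hn.
by exists (phi n), (ln n.+1%:R); split => //; rewrite -lte_fin dualE.
Qed.

End entropy_duality.

(** * Lower semicontinuity of the entropy *)

Section wasserstein_lsc.
Context {R : realType} {X : ptopologicalType} (d : X -> X -> \bar R).
Hypothesis emtd : emt_space d.
Implicit Type q b : {measure set (borel X) -> \bar R}.

Let d0 x y : (0 <= d x y)%E.
Proof. by case: emtd => _ [/(_ x y)]. Qed.

Lemma Rintegral_marginal (pi : {measure set (borel (prodT X X)) -> \bar R}) q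
    (p : prodT X X -> X) (f : X -> R) (M : R) :
  continuous p -> q setT = 1%E ->
  (forall A : set (borel X), measurable A -> pi (p @^-1` A) = q A) ->
  continuous f -> (forall x, `|f x| <= M) ->
  \int[pi]_z f (p z) = \int[q]_x f x.
Proof.
move=> cp q1 pq cf fM.
have mp := continuous_borel cp.
have mf := continuous_borel_fun cf.
have mfp : measurable_fun (setT : set (borel (prodT X X))) (f \o p).
  by apply: continuous_borel_fun => z; apply: continuous_comp; [exact: cp|exact: cf].
have pi1 : pi setT = 1%E by rewrite -q1 -(pq setT measurableT) preimage_setT.
have oo1 : (1%E < +oo :> \bar R)%E by rewrite ltry.
have H : \int[pi]_z (f (p z) + M) = \int[q]_x (f x + M).
  congr fine.
  have mM : measurable_fun (setT : set (borel X)) (fun x => (f x + M)%:E).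
    by apply/measurable_EFinP; exact: measurable_funD.
  rewrite -[LHS](@ge0_integral_pushforward _ _ (borel (prodT X X)) (borel X)
    R p mp pi setT (fun x => (f x + M)%:E) measurableT mM); last first.
    by move=> x _; rewrite lee_fin; have := fM x; rewrite ler_norml => /andP[? _]; lra.
  by apply: eq_measure_integral => A mA _; exact: pq.
move: H; rewrite RintegralD//; first last.
- by apply: (@bounded_integrable _ _ _ pi _ `|M|) => //; rewrite pi1.
- by apply: (@bounded_integrable _ _ _ pi _ M) => //; rewrite pi1.
rewrite RintegralD//; first last.
- by apply: (@bounded_integrable _ _ _ q _ `|M|) => //; rewrite q1.
- by apply: (@bounded_integrable _ _ _ q _ M) => //; rewrite q1.
by rewrite !Rintegral_cst// pi1 q1 => /addIr.
Qed.

(* [L * r <= L * eta + (L / eta) * r ^+ 2] replaces the Cauchy-Schwarz inequality. *)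
Lemma W2sq_lip q b (f : X -> R) (M L s eta : R) :
  q setT = 1%E -> b setT = 1%E -> continuous f -> (forall x, `|f x| <= M) ->
  0 < L -> (forall x y, (`|f x - f y|%:E <= L%:E * d x y)%E) -> 0 < eta ->
  (W2sq d q b < s%:E)%E ->
  `|\int[q]_x f x - \int[b]_x f x| <= L * eta + L / eta * s.
Proof.
move=> q1 b1 cf fM L0 fL eta0 /ereal_inf_lt[_ [pi [[_ pi1] marg] <-] ds].
have pi1oo : (pi setT < +oo)%E by rewrite pi1 ltry.
have c1 : continuous (fst : prodT X X -> X) by move=> z; exact: cvg_fst.
have c2 : continuous (snd : prodT X X -> X) by move=> z; exact: cvg_snd.
have <- : \int[pi]_z f z.1 = \int[q]_x f x.
  apply: (Rintegral_marginal c1 q1 _ cf fM) => A mA.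
  have [<- _] := marg A mA; congr (pi _).
  by apply/seteqP; split => z //= -[].
have <- : \int[pi]_z f z.2 = \int[b]_x f x.
  apply: (Rintegral_marginal c2 b1 _ cf fM) => A mA.
  have [_ <-] := marg A mA; congr (pi _).
  by apply/seteqP; split => z //= -[].
have cf1 : continuous (fun z : prodT X X => f z.1).
  by move=> z; apply: continuous_comp; [exact: c1|exact: cf].
have cf2 : continuous (fun z : prodT X X => f z.2).
  by move=> z; apply: continuous_comp; [exact: c2|exact: cf].
have mf1 := continuous_borel_fun cf1.
have mf2 := continuous_borel_fun cf2.
have M0 : 0 <= M by apply: le_trans (fM point).
have i1 : pi.-integrable setT (EFin \o (fun z : prodT X X => f z.1)).
  exact: (bounded_integrable pi1oo mf1 (fun z => fM z.1)).
have i2 : pi.-integrable setT (EFin \o (fun z : prodT X X => f z.2)).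
  exact: (bounded_integrable pi1oo mf2 (fun z => fM z.2)).
have mf12 : measurable_fun (setT : set (borel (prodT X X)))
    (fun z : prodT X X => f z.1 - f z.2) by exact: measurable_funB.
have i12 : pi.-integrable setT (EFin \o (fun z : prodT X X => f z.1 - f z.2)).
  apply: (bounded_integrable pi1oo mf12 (M := M + M)) => z.
  by rewrite (le_trans (ler_normB _ _))// lerD.
rewrite -RintegralB// (le_trans (le_normr_Rintegral _ i12))//.
(* At distance [r] this excess is at most the positive part of [L * (r - eta)], and
   [eta * (r - eta) <= r ^+ 2]. As [w] is measurable and bounded, the squared distance enters only
   through monotonicity of the integral. *)
pose w (z : prodT X X) : R := Num.max 0 (`|f z.1 - f z.2| - L * eta).
have w0 z : 0 <= w z by rewrite le_max lexx.
have mw : measurable_fun (setT : set (borel (prodT X X))) w.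
  apply: measurable_maxr => //; apply: measurable_funB => //.
  exact: measurableT_comp.
have iw : pi.-integrable setT (EFin \o w).
  apply: (bounded_integrable pi1oo mw (M := M + M)) => z.
  rewrite ger0_norm// ge_max addr_ge0//= lerBlDr.
  rewrite (le_trans (ler_normB _ _))// (le_trans (lerD (fM _) (fM _)))//.
  by rewrite lerDl mulr_ge0 ?(ltW L0) ?(ltW eta0).
have ws : (\int[pi]_z ((eta / L) * w z)%:E <= s%:E)%E.
  apply: le_trans (ltW ds); apply: le_integral_nonmeas => z.
  have := fL z.1 z.2; have := d0 z.1 z.2.
  case: (d z.1 z.2) => [r|_ _|//]; last by rewrite expe2 mulyy leey.
  rewrite lee_fin -EFinM -EFin_expe !lee_fin => r0 fr.
  rewrite mulrAC ler_pdivrMr// /w maxr_pMr ?(ltW eta0)// ge_max mulr0.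
  rewrite mulr_ge0 ?(ltW L0) ?sqr_ge0//=.
  apply: (@le_trans _ _ (eta * (L * r - L * eta))).
    by rewrite ler_pM2l// lerB.
  have -> : eta * (L * r - L * eta) = (eta * r - eta ^+ 2) * L by ring.
  rewrite ler_pM2r//; nra.
have {}ws : \int[pi]_z w z <= L / eta * s.
  have : (eta / L) * \int[pi]_z w z <= s.
    rewrite -RintegralZl// -lee_fin /Rintegral fineK//.
    have := integrableZl measurableT (eta / L) iw.
    move=> h; apply: integrable_fin_num => //.
  rewrite -ler_pdivlMl ?divr_gt0// invf_div. by [].
apply: (@le_trans _ _ (\int[pi]_z (w z + L * eta))).
  apply: le_Rintegral => //.
  - exact: integrable_abse i12.
  - rewrite (_ : EFin \o _ = fun z => ((w z)%:E + (L * eta)%:E)%E) //.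
    by apply: integrableD => //; apply: (@bounded_integrable _ _ _ pi _ `|L * eta|).
  - by move=> z _; rewrite -lerBlDr le_max lexx orbT.
rewrite RintegralD//; last by apply: (@bounded_integrable _ _ _ pi _ `|L * eta|).
by rewrite Rintegral_cst// pi1 mulr1 addrC lerD2l.
Qed.

Lemma expR_lip (M a b : R) : `|a| <= M -> `|b| <= M ->
  `|expR a - expR b| <= expR M * `|a - b|.
Proof.
wlog ab : a b / b <= a.
  move=> H aM bM; have [/H->//|/ltW/H H'] := leP b a.
  by rewrite distrC (distrC a) H'.
move=> aM bM.
rewrite !ger0_norm ?subr_ge0 ?ler_expR//.
apply: (@le_trans _ _ (expR a * (a - b))).
  have := expR_ge1Dx (b - a).
  have a0 := expR_gt0 a; rewrite -(ler_pM2l a0) -expRD (addrC a) subrK; lra.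
rewrite ler_wpM2r ?subr_ge0// ler_expR (le_trans _ aM)//.
exact: ler_norm.
Qed.

Variable m : {measure set (borel X) -> \bar R}.
Hypothesis radm : radon_prob m.

(** A Lipschitz [f] whose dual value at [b] exceeds [c] also works for [q] near [b]: only the
    integral of [f] depends on [q], the exponential term being an integral against [m]. *)
Lemma Ent_W2_lsc b (c : R) : radon_prob b -> (Ent m b < +oo)%E ->
  (c%:E < Ent m b)%E -> exists2 e : R, 0 < e &
    forall q, radon_prob q -> (W2 d q b < e%:E)%E -> (c%:E < Ent m q)%E.
Proof.
move=> [radb b1] Eoo cE; have [radm' m1] := radm.
have boo : (b setT < +oo)%E by rewrite b1 ltry.
have moo : (m setT < +oo)%E by rewrite m1 ltry.
have [phi [M [mphi phiM cphi]]] := Ent_dual_approx m1 b1 Eoo cE.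
have M0 : 0 <= M by apply: le_trans (phiM point).
pose g := Ent_dual m b phi - c.
have g0 : 0 < g by rewrite subr_gt0.
have eM : 0 < 1 + expR M by rewrite ltr_wpDr ?expR_ge0.
(* Passing from [phi] to [f] costs [e1] in the integral against [b] and [expR M * e1] in the
   exponential term, together [g / 2]. *)
pose e1 := g / 2 / (1 + expR M).
have e10 : 0 < e1 by rewrite !divr_gt0.
have laoo : (measure_add m b setT < +oo)%E.
  by rewrite [ltLHS](measure_addE m b) m1 b1 -EFinD ltry.
have [f [Lf fM]] := approximable_bounded emtd laoo
  (inner_regularD emtd (radon_inner_regular emtd radm')
    (radon_inner_regular emtd radb)) mphi phiM e10.
have mf := lip_b_borel Lf.
have mfd := measurable_distr mphi mf.
rewrite ge0_integral_measure_add// => fe.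
have le1 (u v : \bar R) : (0 <= u)%E -> (0 <= v)%E -> (u + v <= e1%:E)%E ->
    fine u <= e1 /\ fine v <= e1.
  case: u => [u||//]; case: v => [v||//] //= ; rewrite ?lee_fin => u0 v0 uv.
  by split; lra.
have I0 (mu : {measure set (borel X) -> \bar R}) :
    (0 <= \int[mu]_x (`|phi x - f x|)%:E)%E by exact: integral_ge0.
have [fem feb] := le1 _ _ (I0 m) (I0 b) fe.
have {}fem : \int[m]_x `|phi x - f x| <= e1 by exact: fem.
have {}feb : \int[b]_x `|phi x - f x| <= e1 by exact: feb.
have ibd (mu : {measure set (borel X) -> \bar R}) (h : X -> R) (N : R) :
    (mu setT < +oo)%E -> measurable_fun (setT : set (borel X)) h ->
    (forall x, `|h x| <= N) -> mu.-integrable setT (EFin \o h).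
  by move=> muoo mh hN; exact: (bounded_integrable muoo mh hN).
have me (h : X -> R) : measurable_fun (setT : set (borel X)) h ->
    measurable_fun (setT : set (borel X)) (fun x => expR (h x)).
  by move=> mh; exact: measurableT_comp.
have eb (h : X -> R) : (forall x, `|h x| <= M) -> forall x, `|expR (h x)| <= expR M.
  move=> hM x; rewrite ger0_norm ?expR_ge0// ler_expR (le_trans _ (hM x))//.
  exact: ler_norm.
have dM x : `|phi x - f x| <= M + M.
  by rewrite (le_trans (ler_normB _ _))// lerD.
have mfd' : measurable_fun (setT : set (borel X)) (fun x => `|phi x - f x|).
  by apply/measurable_EFinP.
have dM' x : `| `|phi x - f x| | <= M + M by rewrite normr_id.
have H1 : \int[b]_x phi x - \int[b]_x f x <= e1.
  rewrite -RintegralB//; [|exact: ibd phiM|exact: ibd fM].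
  apply: le_trans feb; apply: le_Rintegral => //.
  - apply: (ibd _ _ (M + M)) => //; exact: measurable_funB.
  - exact: (ibd _ _ (M + M)).
  - by move=> x _; exact: ler_norm.
have H2 : \int[m]_x expR (f x) - \int[m]_x expR (phi x) <= expR M * e1.
  have ief := ibd m _ _ moo (me _ mf) (eb _ fM).
  have iephi := ibd m _ _ moo (me _ mphi) (eb _ phiM).
  rewrite -RintegralB//.
  apply: (@le_trans _ _ (\int[m]_x (expR M * `|phi x - f x|))); last first.
    rewrite RintegralZl//; last exact: (ibd _ _ (M + M)).
    by rewrite ler_pM2l// expR_gt0.
  apply: le_Rintegral => //.
  - apply: (ibd _ _ (expR M + expR M)) => //.
      by apply: measurable_funB; exact: me.
    by move=> x; rewrite (le_trans (ler_normB _ _))// lerD// eb.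
  - apply: (ibd _ _ (expR M * (M + M))) => //; first exact: measurable_funM.
    by move=> x; rewrite normrM ger0_norm ?expR_ge0// ler_pM2l ?expR_gt0.
  - move=> x _; apply: le_trans (ler_norm _) _.
    by rewrite distrC; exact: expR_lip.
have cf : c + g / 2 <= Ent_dual m b f.
  have : e1 * (1 + expR M) = g / 2 by rewrite /e1 divfK// gt_eqF.
  have -> : c = Ent_dual m b phi - g by rewrite /g; ring.
  rewrite /Ent_dual; lra.
case: Lf => cont_f _ [L [L0 fL]].
have L1 : 0 < L + 1 by rewrite ltr_wpDl.
have fL1 x y : (`|f x - f y|%:E <= (L + 1)%:E * d x y)%E.
  rewrite (le_trans (fL x y))// lee_wpmul2r// lee_fin; lra.
(* With [eta = e] and [s = e ^+ 2], the bound of [W2sq_lip] is [2 * (L + 1) * e = g / 4], below the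
   margin [g / 2]. The constant [L + 1] is positive even when [L = 0]. *)
pose e := g / 8 / (L + 1).
have e0 : 0 < e by rewrite !divr_gt0.
exists e => // q [radq q1] qe.
apply: lt_le_trans (Ent_dual_le m1 q1 mf fM); rewrite lte_fin.
have W0 : (0 <= W2sq d q b)%E.
  by apply: le_ereal_inf_tmp => _ [pi _ <-]; apply: integral_ge0 => z _; exact: sqre_ge0.
have qe2 : (W2sq d q b < (e ^+ 2)%:E)%E.
  move: qe W0; rewrite /W2; case: (W2sq d q b) => [r||//] //= ; rewrite !lte_fin !lee_fin.
  move=> re r0; rewrite -(sqr_sqrtr r0) ltr_sqr ?nnegrE ?sqrtr_ge0//.
  exact: ltW.
have := W2sq_lip q1 b1 cont_f fM L1 fL1 e0 qe2.
have -> : (L + 1) * e + (L + 1) / e * e ^+ 2 = g / 4.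
  have -> : (L + 1) / e * e ^+ 2 = (L + 1) * e.
    by rewrite expr2 mulrA divfK// gt_eqF.
  rewrite /e mulrC divfK ?gt_eqF//; lra.
rewrite ler_norml => /andP[h _]; move: cf; rewrite /Ent_dual; lra.
Qed.

End wasserstein_lsc.

(** * Integration of the EVI *)

Section expint.
Context {R : realType}.
Variable K : R.

(** The integral of [expR (K * s)] over [[0, t]] in closed form; at [K = 0] the quotient would be 0
    instead of [t]. *)
Definition expint (t : R) : R := if K == 0 then t else (expR (K * t) - 1) / K.

Lemma is_derive_expRM (t : R) : is_derive t 1 (fun x => expR (K * x)) (K * expR (K * t)).
Proof.
have h : is_derive t 1 (fun x : R => K * x) K.
  have -> : (fun x : R => K * x) = K \*: (id : R -> R) by [].
  by apply: is_derive_eq; rewrite /GRing.scale /= mulr1.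
have := @is_derive1_comp R expR (fun x => K * x) t _ _ (is_derive_expR _) h.
by rewrite mulrC.
Qed.

Lemma is_derive_expint (t : R) : is_derive t 1 expint (expR (K * t)).
Proof.
rewrite /expint; have [K0|K0] := eqVneq K 0.
  by rewrite K0 mul0r expR0; exact: is_derive_id.
have -> : (fun t => (expR (K * t) - 1) / K) =
    (K^-1 \*: ((fun x => expR (K * x)) - cst 1)) :> (R -> R).
  by apply/funext => x; rewrite mulrC.
have := is_derive_expRM t => h.
by apply: is_derive_eq; rewrite subr0 /GRing.scale /= mulrA mulVf// mul1r.
Qed.

Lemma expint0 : expint 0 = 0.
Proof. by rewrite /expint; case: ifP => // _; rewrite mulr0 expR0 subrr mul0r. Qed.

Lemma expintE t : expR (K * t) = 1 + K * expint t.
Proof.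
rewrite /expint; have [->|K0] := eqVneq K 0; first by rewrite !mul0r expR0 addr0.
by rewrite mulrCA mulfV// mulr1 addrC subrK.
Qed.

Lemma expint_gt0 t : 0 < t -> 0 < expint t.
Proof.
move=> t0; rewrite /expint; have [//|K0] := eqVneq K 0.
have [Kp|Kn|K00] := ltgtP 0 K; last by rewrite K00 eqxx in K0.
- by rewrite divr_gt0// subr_gt0 expR_gt1 mulr_gt0.
- by rewrite nmulr_rgt0 ?invr_lt0// subr_lt0 expR_lt1 nmulr_rlt0.
Qed.

Lemma ac_expRM a b : ac (fun t => expR (K * t)) a b.
Proof.
(* The sum of the two endpoint values bounds the exponential for either sign of [K]. *)
apply: (ac_deriv (df := fun t => K * expR (K * t))
  (M := `|K| * (expR (K * a) + expR (K * b)))).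
  exact: is_derive_expRM.
move=> x /andP[ax xb]; rewrite normrM ler_wpM2l// ger0_norm ?expR_ge0//.
have [K0|K0] := leP 0 K.
- apply: (@le_trans _ _ (expR (K * b))); first by rewrite ler_expR ler_wpM2l.
  by rewrite lerDr expR_ge0.
- apply: (@le_trans _ _ (expR (K * a))); first by rewrite ler_expR ler_wnM2l// ltW.
  by rewrite lerDl expR_ge0.
Qed.

Lemma ac_expint a b : ac expint a b.
Proof.
have [M M0 HM] := ac_bounded (ac_expRM a b).
apply: (ac_deriv (df := fun t => expR (K * t)) (M := M)) => //.
exact: is_derive_expint.
Qed.

End expint.

Section evi.
Context {R : realType} {Y : Type} (dY : Y -> Y -> \bar R).
Hypothesis dYm : ext_metric dY.
Notation mu := (@lebesgue_measure R).

Let d0 x y : (0 <= dY x y)%E. Proof. by case: dYm. Qed.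
Let dC x y : dY x y = dY y x. Proof. by case: dYm. Qed.
Let dT x y z : (dY x z <= dY x y + dY y z)%E. Proof. by case: dYm. Qed.
Let dxx x : dY x x = 0%E. Proof. by case: dYm => _ _ _ ->. Qed.

Lemma loc_abs_cont_ac (y : R -> Y) (z : Y) (a b : R) :
  loc_abs_cont dY y -> 0 < a -> a <= b ->
  (forall t, a <= t <= b -> (dY (y t) z < +oo)%E) ->
  ac (fun t => fine (dY (y t) z)) a b.
Proof.
move=> lac a0 ab fin; have [g [ig yg]] := lac a b a0 ab.
exists (fun x => `|(g \_ `[a, b]) x|); split.
- rewrite (_ : EFin \o _ = abse \o (EFin \o (g \_ `[a, b])))//.
  apply: integrable_abse; rewrite -restrict_EFin.
  exact: (integrable_mkcond _ _).1 ig.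
- by [].
- move=> s t as_ st tb.
  have bs : s <= b by exact: le_trans tb.
  have at_ : a <= t by exact: le_trans st.
  have igst : mu.-integrable `[s, t] (EFin \o g).
    apply: integrableS ig => // x; rewrite /= !in_itv /= => /andP[sx xt].
    by rewrite (le_trans as_)//= (le_trans xt).
  have E1 : \int[mu]_(x in `[s, t]) `|(g \_ `[a, b]) x| = \int[mu]_(x in `[s, t]) `|g x|.
    apply: eq_Rintegral => x; rewrite inE /= in_itv /= => /andP[sx xt].
    by rewrite patchE mem_set//= in_itv /= (le_trans as_)//= (le_trans xt).
  rewrite E1; apply: le_trans (le_normr_Rintegral _ igst) => //.
  have Ifin : (\int[mu]_(u in `[s, t]) (g u)%:E)%E \is a fin_num.
    exact: integrable_fin_num igst.
  have dst : dY (y s) (y t) \is a fin_num.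
    rewrite ge0_fin_numE// (le_lt_trans (yg s t as_ st tb))// -ge0_fin_numE//.
    exact: le_trans (yg s t as_ st tb).
  have ds : dY (y s) z \is a fin_num by rewrite ge0_fin_numE// fin// as_.
  have dt : dY (y t) z \is a fin_num by rewrite ge0_fin_numE// fin// at_.
  apply: le_trans (ler_norm _).
  apply: (@le_trans _ _ (fine (dY (y s) (y t)))); last first.
    by apply: fine_le => //; exact: yg.
  rewrite ler_norml; apply/andP; split.
  - rewrite lerNl opprB lerBlDr -fineD// fine_le// ?fin_numD ?dst ?dt//.
  - rewrite lerBlDr -fineD// fine_le// ?fin_numD ?dst ?ds// (dC (y s)).
    exact: dT.
Qed.

(** Both forms of the initial condition give this: metric convergence to [y0] by the triangle
    inequality, and the other form because [z] lies in the closure of the domain of [E]. *)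
Lemma EVI_flow_initial (K : R) (E : Y -> \bar R) (y0 : Y) (y : R -> Y) (z : Y) :
  EVI_flow K E dY y0 y -> (E z < +oo)%E -> (dY y0 z < +oo)%E ->
  dY (y t) z @[t --> 0^'+] --> dY y0 z.
Proof.
move=> [_ init _] Ez y0z; case: pselect init => [_ init|_ [_ init]]; last first.
  by apply: init => e e0; exists z; split => //; rewrite dxx lte_fin.
have y0zf : dY y0 z \is a fin_num by rewrite ge0_fin_numE.
rewrite -(fineK y0zf).
have H (e : R) : 0 < e -> \forall t \near 0^'+, (dY (y t) y0 < e%:E)%E.
  move=> e0; have [delta [delta0 Hd]] := init e e0.
  near=> t; apply: Hd; apply/andP; split; near: t.
    exact: nbhs_right_gt.
  exact: nbhs_right_lt.
apply/fine_cvgP; split.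
  near=> t; rewrite ge0_fin_numE//.
  have : (dY (y t) y0 < 1%:E)%E by near: t; exact: H.
  move=> h; rewrite (le_lt_trans (dT _ y0 _))// lte_add_pinfty//.
  by rewrite (lt_trans h)// ltry.
apply/cvgrPdist_le => e e0; near=> t.
have h : (dY (y t) y0 < e%:E)%E by near: t; exact: H.
have yt : dY (y t) y0 \is a fin_num by rewrite ge0_fin_numE// (lt_trans h)// ltry.
have ytz : dY (y t) z \is a fin_num.
  by rewrite ge0_fin_numE// (le_lt_trans (dT _ y0 _))// lte_add_pinfty// -ge0_fin_numE.
have he : fine (dY (y t) y0) <= e by rewrite -lee_fin fineK// ltW.
have := dT (y t) y0 z; have := dT y0 (y t) z; rewrite (dC y0 (y t)).
rewrite -(fineK yt) -(fineK ytz) -(fineK y0zf) -!EFinD !lee_fin !fineK// => h1 h2.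
rewrite /= ler_norml; apply/andP; split; lra.
Unshelve. all: by end_near. Qed.

(** The initial limit makes the distance finite at some small [s], and local absolute continuity
    makes the distance from [y s] to [y t] finite. *)
Lemma EVI_flow_fin (K : R) (E : Y -> \bar R) (y0 : Y) (y : R -> Y) (z : Y) :
  EVI_flow K E dY y0 y -> (E z < +oo)%E -> (dY y0 z < +oo)%E ->
  forall t, 0 < t -> (dY (y t) z < +oo)%E.
Proof.
move=> evi Ez y0z t t0.
have init := EVI_flow_initial evi Ez y0z.
have y0zf : dY y0 z \is a fin_num by rewrite ge0_fin_numE.
move: init; rewrite -(fineK y0zf) => /fine_cvgP[fin _].
have [s [s0 st sfin]] : exists s, [/\ 0 < s, s <= t & dY (y s) z \is a fin_num].
  near (0:R)^'+ => s; exists s; split.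
  - by near: s; exact: nbhs_right_gt.
  - by near: s; exact: nbhs_right_le.
  - by near: s.
case: evi => lac _ _; have [g [ig yg]] := lac s t s0 st.
rewrite (le_lt_trans (dT _ (y s) _))// lte_add_pinfty -?ge0_fin_numE//.
rewrite dC ge0_fin_numE//.
rewrite (le_lt_trans (yg s t _ _ _))// ?lexx//.
have : (\int[mu]_(u in `[s, t]) (g u)%:E)%E \is a fin_num by exact: integrable_fin_num ig.
by rewrite fin_numE => /andP[_]; rewrite -ltey.
Unshelve. all: by end_near. Qed.

(* Integrated form of the EVI, with the entropy along the flow replaced by a
   constant lower bound so that no measurability in time is needed. *)
Lemma EVI_flow_integrated (K : R) (E : Y -> \bar R) (y0 : Y) (y : R -> Y) (z : Y)
    (c delta t : R) :
  EVI_flow K E dY y0 y -> (0 <= E z)%E -> (E z < +oo)%E -> (dY y0 z < +oo)%E ->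
  (forall s, 0 < s < delta -> (c%:E <= E (y s))%E) -> 0 < t < delta ->
  expR (K * t) * fine (dY (y t) z) ^+ 2 <=
  fine (dY y0 z) ^+ 2 + 2 * (fine (E z) - c) * expint K t.
Proof.
move=> evi Ez0 Ez y0z cE /andP[t0 td].
have fin := EVI_flow_fin evi Ez y0z.
have init := EVI_flow_initial evi Ez y0z.
have y0zf : dY y0 z \is a fin_num by rewrite ge0_fin_numE.
have Ezf : E z \is a fin_num by rewrite ge0_fin_numE.
pose W s := fine (dY (y s) z).
pose C := fine (E z) - c.
(* Multiplying the EVI by [2 * expR (K * s)] makes it say that [h] has nonpositive derivative. *)
pose h s := expR (K * s) * (W s * W s) - 2 * C * expint K s.
have hW s : W s * W s = W s ^+ 2 by rewrite expr2.
have hdec s : 0 < s -> s <= t -> h t <= h s.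
  move=> s0 st; case: (evi) => lac _ /(_ z Ez) [].
    by exists 1; split => //; rewrite dC; exact: fin.
  move=> N [mN N0 HN].
  apply: ac_nonincr => //.
    have acW : ac W s t.
      by apply: loc_abs_cont_ac => // u /andP[su _]; apply: fin; exact: lt_le_trans su.
    apply: acB; first by apply: acM; [exact: ac_expRM|exact: acM].
    apply: acM; last exact: ac_expint.
    apply: (@ac_deriv _ (cst (2 * C)) (cst 0) _ _ 0).
    by move=> x _; rewrite normr0.
  exists N; split => //; apply: subset_trans HN; apply: subsetC => u /= Hu /andP[su ut].
  have u0 : 0 < u by exact: lt_le_trans su.
  have [df] := Hu u0.
  set f := fun s => fine (dY (y s) z) ^+ 2 => evi_u.
  have {}evi_u : 2^-1 * 'D_1 f u + K / 2 * f u <= C.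
    rewrite -lee_fin; apply: (le_trans evi_u).
    have cEu : (c%:E <= E (y u))%E by apply: cE; rewrite u0 (le_lt_trans ut).
    by rewrite /C EFinB fineK// leeB.
  have hE : h = (fun s => expR (K * s)) * f - (2 * C) \*: expint K.
    by apply/funext => x; rewrite /h hW.
  have ef : is_derive u 1 f ('D_1 f u) by exact: derivableP.
  have e1 := is_derive_expRM K u; have e2 := is_derive_expint K u.
  have hd : is_derive u 1 h (expR (K * u) * ('D_1 f u + K * f u - 2 * C)).
    rewrite hE; apply: is_derive_eq; rewrite /GRing.scale /=; ring.
  split; first by case: hd.
  rewrite (@derive_val _ _ _ _ _ _ _ hd).
  rewrite pmulr_rle0 ?expR_gt0//; lra.
(* Absolute continuity is known only away from time 0, so the initial value is reached as a limit of
   [h s]. *)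
have hlim : h s @[s --> 0^'+] -->
    expR (K * 0) * (fine (dY y0 z) * fine (dY y0 z)) - 2 * C * expint K 0.
  have cW : W s @[s --> 0^'+] --> fine (dY y0 z).
    by apply: fine_cvg; rewrite fineK.
  have cc (g : R -> R) (dg : R -> R) : (forall x : R, is_derive x 1 g (dg x)) ->
      g s @[s --> 0^'+] --> g 0.
    move=> gd; apply: cvg_at_right_filter.
    by apply/differentiable_continuous/derivable1_diffP; case: (gd 0).
  apply: cvgB; last first.
    by apply: cvgM; [exact: cvg_cst|apply: cc; exact: is_derive_expint].
  apply: cvgM; last by apply: cvgM.
  by apply: (cc (fun s => expR (K * s))); exact: is_derive_expRM.
have : h t <= expR (K * 0) * (fine (dY y0 z) * fine (dY y0 z)) - 2 * C * expint K 0.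
  rewrite -(cvg_lim _ hlim)//; apply: limr_ge.
    by apply/cvg_ex; eexists; exact: hlim.
  near=> s; apply: hdec; near: s; [exact: nbhs_right_gt|exact: nbhs_right_le].
rewrite mulr0 expR0 expint0 mulr0 subr0 mul1r /h /W /C -!expr2; lra.
Unshelve. all: by end_near. Qed.

End evi.

(** * Barycenters *)

Local Open Scope ereal_scope.

(** As a supremum of continuous functions, [d p] is lower semicontinuous: its strict superlevel sets
    are open. *)
Lemma emt_measurable {R : realType} {T : ptopologicalType}
    (d : T -> T -> \bar R) (p : T) :
  emt_space d -> measurable_fun (setT : set (borel T)) (d p).
Proof.
case=> _ _ _ dE; apply: (measurability _ (ErealGenOInfty.measurableE R)) => //.
move=> _ [_ [a ->] <-]; rewrite setTI; apply: open_borel.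
rewrite (_ : _ @^-1` _ = \bigcup_(f in [set f | lip_b1 d f])
    [set y | (a < `|f p - f y|)%R]); last first.
  apply/seteqP; split => y /=; rewrite in_itv /= andbT dE.
    by move=> /ereal_sup_gt[_ [f Lf <-]]; rewrite lte_fin => af; exists f.
  move=> [f Lf af]; apply: (@lt_le_trans _ _ `|f p - f y|%:E); first by rewrite lte_fin.
  by apply: ereal_sup_ubound; exists f.
apply: bigcup_open => f [[cf _ _] _].
apply: (@open_comp _ _ (fun y => `|f p - f y|%R) [set r | (a < r)%R]) => [y _|];
  last exact: open_gt.
by apply: cvg_norm; apply: cvgB; [exact: cvg_cst|exact: cf].
Qed.

(** Integrates the flow estimate with [U] and [V] the squared distances to [y t] and to [b],
    [a = expR (K * t)] and [k = 2 * expint K t]. Additivity is applied only to measurable functions;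
    [E] enters by comparison. *)
Lemma integral_minorant d (T : measurableType d) (R : realType)
    (Om : probability T R) (E U V : T -> \bar R) (a k c v : R) :
  (0 <= a)%R -> (0 < k)%R -> (0 <= c)%R ->
  measurable_fun setT U -> (forall w, 0 <= U w) ->
  measurable_fun setT V -> (forall w, 0 <= V w) -> (forall w, 0 <= E w) ->
  (forall w, V w < +oo -> E w < +oo ->
    a%:E * U w + (k * c)%:E <= k%:E * E w + V w) ->
  \int[Om]_w V w = v%:E -> v%:E <= \int[Om]_w U w ->
  (a * v + k * c)%:E <= k%:E * \int[Om]_w E w + v%:E.
Proof.
move=> a0 k0 c0 mU U0 mV V0 E0 H Vv vU.
have k0' : (0 <= k)%R := ltW k0.
pose A := [set w | V w < +oo].
have mA : measurable A.
  by rewrite -[A]setTI; exact: emeasurable_fun_infty_o.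
pose X w := a%:E * U w + (k * c)%:E.
have X0 w : 0 <= X w by rewrite adde_ge0 ?mule_ge0 ?lee_fin ?mulr_ge0.
have mX : measurable_fun setT X.
  by apply: emeasurable_funD => //; exact: measurable_funeM.
(* The least nonnegative solution of [X <= k * g + V] where [V] is finite; it is then set to 0 where
   [V] is infinite and the inequality is trivial. *)
pose g0 w := maxe 0 (k^-1%:E * (X w - V w)).
have mg0 : measurable_fun setT g0.
  apply: measurable_maxe => //; apply: measurable_funeM.
  exact: emeasurable_funB.
pose g := g0 \_ A.
have mg : measurable_fun setT g.
  by apply/(measurable_restrictT _ _).1 => //; exact: measurable_funTS.
have g_ge0 w : 0 <= g w.
  by rewrite /g patchE; case: ifP => // _; rewrite /g0 le_max lexx.
have gE w : g w <= E w.
  rewrite /g patchE; case: ifPn => // /set_mem wA.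
  have [Eoo|] := ltP (E w) +oo; last by rewrite leye_eq => /eqP ->; rewrite leey.
  have Vf : V w \is a fin_num by rewrite ge0_fin_numE.
  have Ef : E w \is a fin_num by rewrite ge0_fin_numE.
  rewrite /g0 ge_max E0 /= muleC lee_pdivrMr// leeBlDr// muleC.
  exact: H.
have Xg w : X w <= k%:E * g w + V w.
  have [wA|] := ltP (V w) +oo; last first.
    rewrite leye_eq => /eqP ->; rewrite addey ?leey// gt_eqF//.
    by rewrite (@lt_le_trans _ _ 0)// mule_ge0.
  have Vf : V w \is a fin_num by rewrite ge0_fin_numE.
  rewrite -leeBlDr// /g patchE mem_set// -lee_pdivrMl//.
  by rewrite /g0 le_max lexx orbT.
have : \int[Om]_w X w <= \int[Om]_w (k%:E * g w + V w).
  exact: le_integral_nonmeas.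
rewrite ge0_integralD//; last 3 first.
- by move=> w _; rewrite mule_ge0// lee_fin.
- exact: measurable_funeM.
- by move=> w _; rewrite lee_fin mulr_ge0.
rewrite ge0_integralD//; last 2 first.
- by move=> w _; rewrite mule_ge0.
- exact: measurable_funeM.
have Om1 : (Om : {measure set T -> \bar R}) setT = 1 by exact: probability_setT.
rewrite !ge0_integralZl_EFin// integral_cst// Om1 mule1 Vv => h.
apply: (@le_trans _ _ (a%:E * \int[Om]_w U w + (k * c)%:E)).
  by rewrite EFinD leeD2r// EFinM lee_wpmul2l.
apply: (le_trans h); rewrite leeD2r// lee_wpmul2l//.
exact: le_integral_nonmeas.
Qed.

(** Otherwise [E] is infinite on the full-measure set [~] N[, hence lies above the measurable
    function](i + 1) * \1_(~[N)], whose integral [i + 1] exceeds that of [E]. *)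
Lemma integral_lty_meets d (T : measurableType d) (R : realType)
    (Om : probability T R) (E V : T -> \bar R) :
  measurable_fun setT V -> (forall w, 0 <= V w) -> (forall w, 0 <= E w) ->
  \int[Om]_w V w < +oo -> \int[Om]_w E w < +oo ->
  exists w, E w < +oo /\ V w < +oo.
Proof.
move=> mV V0 E0 Voo Eoo; apply: contrapT => /forallNP H.
have [N [mN N0 HN]] : {ae Om, forall w, setT w -> V w \is a fin_num}.
  apply: integrable_ae => //; apply/integrableP; split => //.
  by under eq_integral => w _ do rewrite gee0_abs//.
have Ef : \int[Om]_w E w \is a fin_num by rewrite ge0_fin_numE// integral_ge0.
pose i := fine (\int[Om]_w E w).
have i0 : (0 <= i)%R by rewrite fine_ge0// integral_ge0.
have : \int[Om]_w ((i + 1)%:E * (\1_(~` N) w)%:E) <= \int[Om]_w E w.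
  apply: le_integral_nonmeas => w; have [Nw|NNw] := pselect (N w).
    by rewrite indicE memNset ?mule0// => /(_ Nw).
  have -> : E w = +oo; last exact: leey.
  have Vw : V w \is a fin_num.
    by apply: contrapT => Vw; apply: NNw; apply: HN => /= /(_ Logic.I).
  have [Ew|] := ltP (E w) +oo; last by rewrite leye_eq => /eqP.
  by exfalso; apply: (H w); split => //; rewrite -ge0_fin_numE.
rewrite ge0_integralZl_EFin ?addr_ge0//; last first.
  by apply/measurable_EFinP; apply: measurable_indic; exact: measurableC.
rewrite integral_indic//; last exact: measurableC.
have NC1 : (Om : {measure set T -> \bar R}) (~` N) = 1.
  by rewrite [LHS]probability_setC// [X in _ - X]N0 sube0.
rewrite setIT NC1 mule1 -(fineK Ef) lee_fin -/i.
by rewrite gerDl ler10.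
Qed.

Theorem theorem5p3 (R : realType) (K : R)
    (X : ptopologicalType) (d : X -> X -> \bar R)
    (m : {measure set (borel X) -> \bar R})
    (P : ptopologicalType) (iota : P -> {measure set (borel X) -> \bar R})
    (Om : probability (borel P) R) :
  emm_space d m ->
  models_PX iota ->
  emt_space (fun p q : P => W2 d (iota p) (iota q)) ->
  radon_prob Om ->
  Var d iota Om < +oo ->
  (forall p : P,
      (exists q : P, Ent m (iota q) < +oo /\ W2 d (iota p) (iota q) < +oo) ->
      exists y : R -> P,
        EVI_flow K (fun q : P => Ent m (iota q))
                   (fun p1 p2 : P => W2 d (iota p1) (iota p2)) p y) ->
  forall b : P, barycenter d iota Om b ->
    Ent m (iota b) <= \int[Om]_w Ent m (iota w)
                      - (K / 2)%:E * \int[Om]_w W2sq d (iota b) (iota w)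
    /\ (\int[Om]_w Ent m (iota w) < +oo -> iota b `<< m).
Proof.
move=> [emtd _ radm _] [_ modP] emtP _ Varoo flow b bary.
pose dP p q := W2 d (iota p) (iota q).
pose E p := Ent m (iota p).
pose V p w := W2sq d (iota p) (iota w).
have dPm : ext_metric dP by case: emtP.
have radP p : radon_prob (iota p) by apply/modP; exists p.
have mass1 p : iota p setT = 1 by have [] := radP p.
have m1 : m setT = 1 by case: radm.
have E0 p : 0 <= E p by exact: Ent_ge0.
have V0 p w : 0 <= V p w.
  by apply: le_ereal_inf_tmp => _ [pi _ <-]; apply: integral_ge0 => z _; exact: sqre_ge0.
have VE p w : V p w = dP p w ^+ 2 by rewrite -(sqr_sqrte (V0 p w)).
have VC p w : V p w = V w p by rewrite !VE; case: dPm => _ -> _ _.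
have dP0 p w : 0 <= dP p w by case: dPm.
have VdP p w : (V p w < +oo) = (dP p w < +oo).
  rewrite -(ge0_fin_numE (V0 p w)) -(ge0_fin_numE (dP0 p w)).
  by rewrite /dP /W2 (sqrte_fin_num (V0 p w)).
have mV p : measurable_fun (setT : set (borel P)) (V p).
  have mdP : measurable_fun (setT : set (borel P)) (dP p) := emt_measurable p emtP.
  rewrite (_ : V p = fun w => dP p w * dP p w); first exact: emeasurable_funM.
  by apply/funext => w; rewrite VE expe2.
have VarE : \int[Om]_w V b w = Var d iota Om.
  by rewrite -bary; apply: eq_integral => w _; exact: VC.
have Var_le p : Var d iota Om <= \int[Om]_w V p w.
  have -> : \int[Om]_w V p w = \int[Om]_w W2sq d (iota w) (iota p).
    by apply: eq_integral => w _; exact: VC.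
  by apply: ereal_inf_lbound; exists p.
have Var0 : 0 <= Var d iota Om by rewrite -VarE; exact: integral_ge0.
have Varf : Var d iota Om \is a fin_num by rewrite ge0_fin_numE.
pose v := fine (Var d iota Om).
have Vv : \int[Om]_w V b w = v%:E by rewrite VarE fineK.
have int0 : 0 <= \int[Om]_w E w by exact: integral_ge0.
suff main : \int[Om]_w E w < +oo ->
    E b <= \int[Om]_w E w - (K / 2)%:E * v%:E.
  have ineq : E b <= \int[Om]_w E w - (K / 2)%:E * \int[Om]_w V b w.
    rewrite Vv; have [/main//|] := ltP (\int[Om]_w E w) +oo.
    by rewrite leye_eq => /eqP ->; rewrite -EFinM -EFinN addye ?leey.
  split => // Eoo; have : E b < +oo.
    rewrite (le_lt_trans (main Eoo))// -EFinM.
    by rewrite -[X in X - _](@fineK _ (\int[Om]_w E w)) ?ge0_fin_numE// -EFinB ltry.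
  rewrite /E /Ent; case: pselect => // -[rho [mrho rho0 rhoE]] _.
  apply/null_content_dominatesP => A mA mA0; rewrite rhoE// null_set_integral//.
  by apply: measurable_funTS; exact/measurable_EFinP.
move=> Eoo; have Ef : \int[Om]_w E w \is a fin_num by rewrite ge0_fin_numE.
pose i := fine (\int[Om]_w E w).
have Voo : \int[Om]_w V b w < +oo by rewrite Vv ltry.
have [q [Eq Vq]] := integral_lty_meets (mV b) (V0 b) E0 Voo Eoo.
have [y evi] : exists y, EVI_flow K E dP b y.
  by apply: flow; exists q; split => //; rewrite -VdP.
(* With [I = expint K t] at the fixed time [t = delta / 2], integration gives [(1 + K * I) * v + 2 *
   I * c <= 2 * I * i + v]: the two [v] cancel, and [2 * I] is divided out. *)
have claim (c : R) : (0 <= c)%R -> (exists2 delta : R, (0 < delta)%R &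
    forall t : R, (0 < t < delta)%R -> c%:E <= E (y t)) -> (c + K / 2 * v <= i)%R.
  move=> c0 [delta delta0 cE].
  pose t := (delta / 2)%R.
  have t0 : (0 < t)%R by rewrite divr_gt0.
  have tdelta : (0 < t < delta)%R by rewrite t0 /t ltr_pdivrMr// ltr_pMr// ltr1n.
  have k0 : (0 < 2 * expint K t)%R by rewrite mulr_gt0// expint_gt0.
  have H w : V b w < +oo -> E w < +oo ->
      (expR (K * t))%:E * V (y t) w + (2 * expint K t * c)%:E <=
      (2 * expint K t)%:E * E w + V b w.
    rewrite VdP => Vw Ew.
    have yt := EVI_flow_fin dPm evi Ew Vw t0.
    have := EVI_flow_integrated dPm evi (E0 w) Ew Vw cE tdelta.
    rewrite !VE; case: (dP (y t) w) yt (dP0 (y t) w) => [r1||//] // _ _.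
    case: (dP b w) Vw (dP0 b w) => [r2||//] // _ _.
    case: (E w) Ew (E0 w) => [e||//] // _ _ /= h.
    by rewrite -!EFinM -!EFinD lee_fin -!expr2; lra.
  have := integral_minorant (expR_ge0 _) k0 c0 (mV (y t)) (V0 (y t))
    (mV b) (V0 b) E0 H Vv _.
  rewrite /v fineK// => /(_ (Var_le _)); rewrite -/v.
  rewrite -(fineK Ef) -/i -(fineK Varf) -/v -EFinM -EFinD lee_fin expintE.
  have p0 := expint_gt0 K t0; move=> h.
  rewrite -(ler_pM2l p0); lra.
(* The case [c = 0] ensures that any [c] above [i - K / 2 * v] is nonnegative, as [claim]
   requires. *)
have Kv0 : (K / 2 * v <= i)%R.
  have := claim 0%R (lexx _); rewrite add0r; apply.
  by exists 1%R => // t _; exact: E0.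
rewrite -(fineK Ef) -/i -EFinM -EFinB leNgt; apply/negP => iE.
have [c [c0 ic cE]] : exists c : R, [/\ (0 <= c)%R, (i - K / 2 * v < c)%R & c%:E < E b].
  case Eb : (E b) iE => [e| |]//; rewrite ?lte_fin => iE.
  - exists ((i - K / 2 * v + e) / 2)%R; split; rewrite ?lte_fin; lra.
  - by exists (i - K / 2 * v + 1)%R; split; rewrite ?ltry//; lra.
suff : (c + K / 2 * v <= i)%R by lra.
apply: claim => //; case: (evi) => _ init _; case: pselect init => [Eb init|_ [init _]].
- have [e e0 He] := Ent_W2_lsc emtd radm (radP b) Eb cE.
  have [delta [delta0 Hd]] := init e e0.
  by exists delta => // t /Hd; move/(He _ (radP _)) => /ltW.
- have [delta [delta0 Hd]] := init _ cE.
  by exists delta => // t /Hd /ltW.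
Qed.
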